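(* For all integers $n,k\ge0$ there is a bijection $g:\mathscr{T}_n^k\to\mathcal{C}_n^k$ with $w_{\mathcal{C}}^{\mathrm{lr}}(g(\lambda))=w_{\mathscr{T}}^{\mathrm{ch}}(\lambda)$ for all $\lambda$; in particular $\sum_{\lambda\in\mathscr{T}_n^k}x^{w_{\mathscr{T}}^{\mathrm{ch}}(\lambda)}=\sum_{\lambda\in\mathcal{C}_n^k}x^{w_{\mathcal{C}}^{\mathrm{lr}}(\lambda)}$.
   Context: Colored symbols $i^r$ (red) and $j^b$ (blue), compared within a color by value. $\mathscr{T}_n^k$ (double alternative trees): pairs $(T_1,T_2)$ of labeled rooted trees whose vertex sets partition $\{0^r,\dots,n^r,0^b,\dots,k^b\}$, roots $0^r$ (of $T_1$) and $0^b$ (of $T_2$), children of red vertices blue and of blue vertices red, and every descendant of a vertex $v$ with the same color as $v$ is larger than $v$. $w_{\mathscr{T}}^{\mathrm{ch}}(\lambda)$ = number of children of $0^r$ that are not leaves. $\mathcal{C}_n^k$ (double Callan permutations): pairs of possibly empty strings $(S_1,S_2)$ using each of $1^r,\dots,n^r,1^b,\dots,k^b$ exactly once in total, with $S_1$ (if nonempty) starting with a blue element, $S_2$ (if nonempty) starting with a red element, and every maximal run of consecutive same-colored elements decreasing. Writing $S_1=B_1R_1\cdots B_\ell R_\ell B_{\ell+1}$ (blue runs $B_i$, red runs $R_i$, $\ell\ge0$, $B_{\ell+1}$ possibly empty), $w_{\mathcal{C}}^{\mathrm{lr}}(\lambda)$ is the number of $i\in\{1,\dots,\ell\}$ with $\min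 B_i<\min B_j$ for all $j<i$. *)

(* Defs.v *)
From HB Require Import structures.
From mathcomp Require Import all_boot all_order all_algebra.

Set Implicit Arguments.
Unset Strict Implicit.
Unset Printing Implicit Defensive.

(* [inl i] is the red symbol i^r (0 <= i <= n), [inr j] the blue symbol j^b
   (0 <= j <= k). *)
Definition symbol (n k : nat) : finType := ('I_n.+1 + 'I_k.+1)%type.

Definition red n k (v : symbol n k) : bool := if v is inl _ then true else false.

Definition label n k (v : symbol n k) : nat :=
  match v with inl i => i | inr j => j end.

Definition red0 n k : symbol n k := inl ord0.
Definition blue0 n k : symbol n k := inr ord0.

(* A rooted tree whose vertices are some of the elements of V, given by its set
   of vertices and its set of arcs (parent, child); the root is a separate
   parameter of [is_rooted_tree]. *)
Definition tree_data (V : finType) : finType := ({set V} * {set V * V})%type.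

Section RootedTrees.
Variable V : finType.
Implicit Types (t : tree_data V) (u v : V).

Definition vertices t : {set V} := t.1.
Definition child_of t : rel V := fun v u => (v, u) \in t.2.
Definition children t v : {set V} := [set u | child_of t v u].
Definition leaf t v : bool := children t v == set0.

Definition descendant t v u : bool := (u != v) && connect (child_of t) v u.

Definition is_rooted_tree (r : V) t : bool :=
  [&& r \in vertices t,
      [forall v, forall u,
        child_of t v u ==> (v \in vertices t) && (u \in vertices t)],
      [forall v, ~~ child_of t v r],
      [forall u in vertices t, (u != r) ==> (#|[set v | child_of t v u]| == 1)]
    & [forall u in vertices t, connect (child_of t) r u]].

End RootedTrees.

Section DoubleAlternativeTrees.
Variables n k : nat.

Definition alternating (t : tree_data (symbol n k)) : bool :=
  [forall v, forall u, child_of t v u ==> (red v != red u)].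

Definition increasing_by_color (t : tree_data (symbol n k)) : bool :=
  [forall v, forall u,
    descendant t v u ==> (red v == red u) ==> (label v < label u)].

Definition is_double_alt_tree
    (T : tree_data (symbol n k) * tree_data (symbol n k)) : bool :=
  [&& is_rooted_tree (red0 n k) T.1, is_rooted_tree (blue0 n k) T.2,
      vertices T.1 :|: vertices T.2 == [set: symbol n k],
      [disjoint vertices T.1 & vertices T.2],
      alternating T.1 && alternating T.2
    & increasing_by_color T.1 && increasing_by_color T.2].

Definition double_alt_tree : finType :=
  {T : tree_data (symbol n k) * tree_data (symbol n k) | is_double_alt_tree T}.

Definition w_ch (T : double_alt_tree) : nat :=
  let t := (val T).1 in #|[set v in children t (red0 n k) | ~~ leaf t v]|.

End DoubleAlternativeTrees.

Section DoubleCallanPermutations.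
Variables n k : nat.
Implicit Types s : seq (symbol n k).

Fixpoint runs s : seq (seq (symbol n k)) :=
  if s isn't x :: s' then [::] else
  match runs s' with
  | (y :: r) :: rs =>
      if red x == red y then (x :: y :: r) :: rs else [:: x] :: (y :: r) :: rs
  | _ => [:: [:: x]]
  end.

Definition decreasing s : bool := sorted (fun x y => label y < label x) s.

Definition starts_blue s : bool := if s is x :: _ then ~~ red x else true.
Definition starts_red s : bool := if s is x :: _ then red x else true.

Definition is_double_callan s1 s2 : bool :=
  [&& perm_eq (s1 ++ s2) [seq v <- enum (symbol n k) | label v != 0],
      starts_blue s1, starts_red s2,
      all decreasing (runs s1) & all decreasing (runs s2)].

(* Strings of length at most n + k are used only to obtain a finite type: the
   length of S_1 S_2 is n + k anyway by [is_double_callan]. *)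
Definition double_callan : finType :=
  {S : (n + k).-bseq (symbol n k) * (n + k).-bseq (symbol n k)
     | is_double_callan S.1 S.2}.

(* Only meaningful when s is nonempty. *)
Definition min_label s : nat :=
  if s is x :: s' then foldr minn (label x) (map (@label n k) s') else 0.

(* As S_1 starts with a blue element, the runs of S_1 are
   B_1, R_1, ..., B_l, R_l, followed by B_(l+1) if it is nonempty; hence l is
   half the number of runs.  Indices are shifted: [blue_run s i] is B_(i+1). *)
Definition nb_blocks s : nat := (size (runs s))./2.
Definition blue_run s (i : nat) : seq (symbol n k) := nth [::] (runs s) i.*2.

Definition w_lr (S : double_callan) : nat :=
  let s1 : seq (symbol n k) := (val S).1 in
  #|[set i : 'I_(nb_blocks s1) | [forall j : 'I_(nb_blocks s1), (j < i) ==>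
      (min_label (blue_run s1 i) < min_label (blue_run s1 j))]]|.

End DoubleCallanPermutations.

(* Main.v *)
(* Both objects decompose as a sequence of components indexed by decreasing
   minima.  The child [v] of a root is the minimum, in its color, of its subtree;
   if the trees below [v] are recursively coded by a word [t ++ L], where [L] is
   the maximal suffix of the color of [v], then the tree of [v] is coded by the
   block [L ++ v :: t].  Concatenating the blocks of the non-leaf children in
   decreasing order, and then the leaves in decreasing order, gives a word whose
   left-to-right minima are exactly the non-leaf children: the leaves form the
   final run.  The first block of a word is recognized as the part preceding the
   next run with an element smaller than [v], the final run being excluded. *)

(* Moving [L] to the front of the block is what keeps the runs decreasing: the block of a non-leaf
   [v] ends with the other color, so the next block, which starts with the color of [v], opens a new
   run; and [v] may follow [L] because it is smaller than all elements of its color below it. The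
   two roots have label 0 and do not occur in words. The forest below [0^r] has blue roots (color
   [false]) and gives [S_1]; the forest below [0^b] gives [S_2]; both are coded in the same way,
   with the colors exchanged. A tree is here a set of arcs, while the coding is a recursion on
   ordered data. The passage has two stages: a pair of trees is replaced by its parent function,
   where the condition on all descendants becomes local (vertex against grandparent), and then by a
   pair of forests whose siblings are put in a canonical order, so that equal trees give equal
   forests. The bijection is built as a relation that is total and single-valued in both directions,
   which avoids writing the inverse as a program. *)
Require Import Defs.
From mathcomp Require Import all_boot all_order all_algebra.
From mathcomp Require Import zify.

Set Implicit Arguments.
Unset Strict Implicit.
Unset Printing Implicit Defensive.

(* First-child/next-sibling coding: [Node v G1 G2] is the tree with root [v] whose
   children form [G1], followed by the forest [G2]. *)
Inductive forest (V : Type) := Empty | Node of V & forest V & forest V.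
Arguments Empty {V}.

Section ForestData.
Variable V : Type.
Implicit Type F : forest V.

Definition is_empty F : bool := if F is Empty then true else false.

Fixpoint root_seq F : seq V := if F is Node v _ G then v :: root_seq G else [::].

Fixpoint labels F : seq V :=
  if F is Node v G1 G2 then v :: labels G1 ++ labels G2 else [::].

Fixpoint nb_nonleaf F : nat :=
  if F is Node _ G1 G2 then ~~ is_empty G1 + nb_nonleaf G2 else 0.

Lemma is_emptyE F : is_empty F = nilp (root_seq F).
Proof. by case: F. Qed.

End ForestData.

(** * Words of two-colored forests, and injectivity of the coding *)

Section Words.
Variables n k : nat.
Local Notation V := (symbol n k).
Implicit Types (s t L w : seq V) (u v x y : V) (c : bool) (F G : forest V).

Definition has_color c : pred V := fun v => red v == c.

Definition starts c s : bool := if s is x :: _ then red x == c else true.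
Definition ends c s : bool := starts c (rev s).

(** A local form of the condition on runs, made precise by [decreasing_runs]: only neighbours are
    compared, so it passes to factors of a word. The relation is not transitive, hence
    [sorted run_rel] gives an inequality between distant elements only inside a run. *)
Definition run_rel : rel V := fun x y => (red x == red y) ==> (label y < label x).

Lemma ends_rcons c s x : ends c (rcons s x) = (red x == c).
Proof. by rewrite /ends rev_rcons. Qed.

Lemma ends_last c x s : ends c (x :: s) = (red (last x s) == c).
Proof. by rewrite lastI ends_rcons. Qed.

Lemma ends_cat c s t : t != [::] -> ends c (s ++ t) = ends c t.
Proof. by case/lastP: t => // t x _; rewrite -rcons_cat !ends_rcons. Qed.

Lemma starts_cat c s t : s != [::] -> starts c (s ++ t) = starts c s.
Proof. by case: s. Qed.

Lemma neg_color c v : (red v != c) = (red v == ~~ c).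
Proof. by case: (red v) c => [] []. Qed.

Lemma all_starts c s : all (has_color c) s -> starts c s.
Proof. by case: s => //= x s /andP[]. Qed.

Lemma all_ends c s : all (has_color c) s -> ends c s.
Proof. by rewrite -all_rev; apply: all_starts. Qed.

Lemma split_color_prefix c s : exists L t,
  [/\ s = L ++ t, all (has_color c) L & starts (~~ c) t].
Proof.
elim: s => [|x s [L [t [-> cL ct]]]]; first by exists [::], [::].
case cx: (red x == c).
  by exists (x :: L), t; split=> //=; rewrite /has_color cx.
by exists [::], (x :: L ++ t); split=> //=; rewrite -neg_color cx.
Qed.

Lemma color_prefix_uniq c L1 t1 L2 t2 :
    all (has_color c) L1 -> starts (~~ c) t1 ->
    all (has_color c) L2 -> starts (~~ c) t2 ->
  L1 ++ t1 = L2 ++ t2 -> L1 = L2 /\ t1 = t2.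
Proof.
elim: L1 L2 => [|x L1 IH] [|y L2] //=.
- by move=> _ ct1 /andP[cy _] _ et; move: ct1 cy; rewrite et /= /has_color -neg_color => /negPf->.
- by move=> /andP[cx _] _ _ ct2 et; move: ct2 cx; rewrite -et /= /has_color -neg_color => /negPf->.
by move=> /andP[_ c1] ct1 /andP[_ c2] ct2 [-> /(IH _ c1 ct1 c2 ct2)[-> ->]].
Qed.

Lemma sorted_cat s t : sorted run_rel (s ++ t) -> sorted run_rel s /\ sorted run_rel t.
Proof. by move=> st; split; [have := prefix_sorted (prefix_prefix s t) st| have := suffix_sorted (suffix_suffix s t) st]. Qed.

Lemma sorted_cat_color c s t : ends (~~ c) s -> starts c t ->
  sorted run_rel (s ++ t) = sorted run_rel s && sorted run_rel t.
Proof.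
case: s => //= x s; rewrite ends_last cat_path => /eqP cs.
case: t => //= y t /eqP cy; congr (_ && _).
by rewrite {1}/run_rel cs cy; case: (c).
Qed.

Lemma sorted_color_gt c L v t : all (has_color c) L -> red v = c ->
  sorted run_rel (L ++ v :: t) -> {in L, forall x, label v < label x}.
Proof.
elim: L => //= x L IH /andP[/eqP cx cL] cv st.
have sL : sorted run_rel (L ++ v :: t) := path_sorted st.
move=> y; rewrite inE => /predU1P[->|]; last exact: IH.
case: L => [|z L] /= in cL IH sL st *.
  by case/andP: st; rewrite /run_rel cx cv eqxx.
case/andP: st; case/andP: (cL) => /eqP cz _; rewrite {1}/run_rel cx cz eqxx /= => zx _.
by apply: ltn_trans zx; apply: IH => //; rewrite inE eqxx.
Qed.

(** Here [m] is the length of [s] without its longest suffix of the color of [v]; if all of [s] has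
    that color, [find] returns the size of [s] and [m] is 0. *)
Definition block v s : seq V :=
  let m := size s - find (fun x => red x != red v) (rev s) in
  drop m s ++ v :: take m s.

Lemma blockE v s L : all (has_color (red v)) L -> ends (~~ red v) s ->
  block v (s ++ L) = L ++ v :: s.
Proof.
move=> cL cs; rewrite /block; set a := fun _ => _.
suff -> : find a (rev (s ++ L)) = size L.
  by rewrite size_cat addnK drop_size_cat // take_size_cat.
rewrite rev_cat find_cat (_ : has a (rev L) = false); last first.
  by apply/hasPn => x; rewrite mem_rev => /(allP cL); rewrite /a negbK.
rewrite size_rev; move: cs; rewrite /ends; case: (rev s) => [|x r] /=.
  by rewrite addn0.
by rewrite /a neg_color => ->; rewrite addn0.
Qed.

Lemma split_color_suffix c s : exists t L,
  [/\ s = t ++ L, all (has_color c) L & ends (~~ c) t].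
Proof.
have [L [t [es cL ct]]] := split_color_prefix c (rev s).
exists (rev t), (rev L); split; last by rewrite /ends revK.
  by rewrite -rev_cat -es revK.
by rewrite all_rev.
Qed.

Fixpoint word F : seq V :=
  if F is Node v G1 G2 then block v (word G1) ++ word G2 else [::].

(* Canonical order of siblings: first the non-leaves, then the leaves, each by
   decreasing label. *)
Definition sibling_ok v G1 G2 : bool :=
  if G2 is Node u H1 _ then
    if is_empty G1 then is_empty H1 && (label u < label v)
    else is_empty H1 || (label u < label v)
  else true.

(** The color condition of the trees appears as minimality of each vertex, in its color, within its
    own subtree. The sibling condition selects one ordering of each unordered forest. *)
Fixpoint valid_forest c F : bool :=
  if F is Node v G1 G2 then
    [&& red v == c, valid_forest (~~ c) G1, valid_forest c G2,
        all (fun x => (red x == c) ==> (label v < label x)) (labels G1)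
      & sibling_ok v G1 G2]
  else true.

Lemma valid_node c v G1 G2 : valid_forest c (Node v G1 G2) ->
  [/\ red v = c, valid_forest (~~ c) G1, valid_forest c G2,
     all (fun x => (red x == c) ==> (label v < label x)) (labels G1)
   & sibling_ok v G1 G2].
Proof. by case/and5P=> /eqP. Qed.

Lemma perm_block v s : perm_eq (block v s) (v :: s).
Proof.
rewrite /block; set m := size s - _.
by rewrite -cat_rcons perm_catC -cats1 catA perm_catC /= perm_cons cat_take_drop.
Qed.

Lemma perm_word F : perm_eq (word F) (labels F).
Proof.
elim: F => //= v G1 IH1 G2 IH2.
by rewrite -cat_cons perm_cat // (perm_trans (perm_block _ _)) // perm_cons.
Qed.

Lemma word_nil F : (word F == [::]) = is_empty F.
Proof. by case: F => //= v G1 G2; rewrite -size_eq0 size_cat (perm_size (perm_block _ _)). Qed.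

Lemma word_leaves c v F : valid_forest c (Node v Empty F) ->
  all (has_color c) (word (Node v Empty F)).
Proof.
elim: F v => [|u H1 _ H2 IH] v //=.
case/and3P=> cv vF /andP[e1 _]; rewrite /has_color cv.
by case: H1 e1 vF => // _ vF; rewrite IH.
Qed.

(** A leaf in first position forces all later siblings to be leaves, so the word is a single run.
    Otherwise [L] followed by [v] is exactly the first run, and [t] starts and ends with the other
    color, so its runs merge with nothing on either side. *)
Variant word_spec c v G1 G2 : seq V -> Prop :=
| WordLeaf of G1 = Empty & all (has_color c) (word G2) :
    word_spec c v G1 G2 (v :: word G2)
| WordBlock t L of ~~ is_empty G1 & word G1 = t ++ L & all (has_color c) L
    & t != [::] & starts (~~ c) t & ends (~~ c) t :
    word_spec c v G1 G2 ((L ++ v :: t) ++ word G2).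

Lemma valid_word_starts c F : valid_forest c F -> starts c (word F).
Proof.
elim: F c => //= v G1 IH1 G2 IH2 c /and4P[/eqP cv v1 v2 _].
have [t [L [eG cL ct]]] := split_color_suffix c (word G1).
rewrite eG blockE ?cv //; case: L cL {eG} => [|x L] /=; first by rewrite cv.
by case/andP.
Qed.

Lemma wordP c v G1 G2 : valid_forest c (Node v G1 G2) ->
  word_spec c v G1 G2 (word (Node v G1 G2)).
Proof.
move=> vF; have [cv v1 v2 _ _] := valid_node vF.
have [e1|ne1] := boolP (is_empty G1).
  case: G1 e1 v1 vF => // _ _ vF; constructor=> //.
  by have /andP[] := word_leaves vF.
have [t [L [eG cL ct]]] := split_color_suffix c (word G1).
rewrite /= eG blockE ?cv //.
have st := valid_word_starts v1; have nG := ne1; rewrite -word_nil eG in nG.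
have nt : t != [::].
  (* With [t] empty, [word G1] would be [L], of color [c], although it starts with color [~~ c]. *)
  apply: contraNneq nG => t0; move: st; rewrite eG t0 /=.
  by case: (L) cL => //= x L' /andP[/eqP->]; case: (c).
by apply: WordBlock => //; move: st; rewrite eG starts_cat.
Qed.

(** Only two junctions join elements of the same color: the last element of [L] with [v], settled by
    minimality of [v] in its subtree, and two consecutive leaves, settled by the order of
    siblings. *)
Lemma valid_word_sorted c F : valid_forest c F -> sorted run_rel (word F).
Proof.
elim: F c => // v G1 IH1 G2 IH2 c vF.
have [cv v1 v2 gtv sib] := valid_node vF.
have := valid_word_starts v2; have := IH2 _ v2; have := IH1 _ v1.
case: (wordP vF) => [e1 c2 _ s2 st2|t L ne1 e1 cL nt st et s1 s2 st2].
  case: G2 sib v2 s2 {IH2 vF c2 st2} => // u H1 H2; rewrite e1 /= => /andP[eH uv] v2.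
  case: H1 eH v2 => //= _ /andP[/eqP cu _]; rewrite /run_rel => ->.
  by rewrite cu cv eqxx uv.
rewrite (sorted_cat_color (c := c)) // ?s2 ?andbT; last first.
  by rewrite ends_cat // -cat1s ends_cat.
rewrite e1 in s1; have [{}s1 sL] := sorted_cat s1.
have svt : sorted run_rel (v :: t).
  case: t st s1 {nt e1 et} => //= x t /eqP cx ->.
  by rewrite /run_rel cx cv; case: (c).
case: L cL sL e1 => [|x L] // cL sL e1; rewrite /= cat_path (sL : path _ _ _) /= -/(sorted _ (v :: t)).
have xL : last x L \in x :: L by rewrite mem_last.
apply/andP; split=> //.
rewrite /run_rel (eqP (allP cL _ xL)) cv eqxx.
have := allP gtv (last x L); rewrite -(perm_mem (perm_word G1)) e1 mem_cat xL orbT => /(_ isT).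
by rewrite (eqP (allP cL _ xL)) eqxx.
Qed.


Lemma color_contra c s : s != [::] -> all (has_color c) s -> ends (~~ c) s = false.
Proof.
by case/lastP: s => // s x _; rewrite all_rcons ends_rcons => /andP[/eqP-> _]; case: c.
Qed.

(* The siblings cannot start inside [t]: their first run would then be followed
   by another run, hence end with a root smaller than [v], whereas [t] only has
   larger elements of this color. *)
Lemma block_end_leq c v t w t' G :
    ends (~~ c) t -> {in t, forall x, red x = c -> label v < label x} ->
    valid_forest c G ->
    (forall u H1 H2, G = Node u H1 H2 -> is_empty H1 || (label u < label v)) ->
  t ++ w = t' ++ word G -> size t <= size t'.
Proof.
move=> et gt vG sib eq_tw; rewrite leqNgt; apply/negP => lt_t.
pose r := drop (size t') t.
have er : t = t' ++ r.
  rewrite -[LHS](cat_take_drop (size t')); congr (_ ++ _).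
  by have := congr1 (take (size t')) eq_tw; rewrite take_cat lt_t take_size_cat.
have nr : r != [::] by rewrite -size_eq0 size_drop subn_eq0 -ltnNge.
have endr : ends (~~ c) r by rewrite er ends_cat in et.
have {}eq_tw : r ++ w = word G.
  by move: eq_tw; rewrite er -catA => /eqP; rewrite eqseq_cat // eqxx => /eqP.
case: G vG sib eq_tw => [|u H1 H2] vG sib.
  by case: (r) nr.
have [cu _ _ _ _] := valid_node vG.
case: (wordP vG) => [_ c2 eq_r|L1 L nH _ cL nt st _ eq_r].
  have : all (has_color c) r.
    have : all (has_color c) (r ++ w) by rewrite eq_r /= c2 andbT /has_color cu.
    by rewrite all_cat => /andP[].
  by move/(color_contra nr); rewrite endr.
have [L0 [r0 [er0 cL0 sr0]]] := split_color_prefix c r.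
have nr0 : r0 != [::].
  by apply: contraTneq endr => r00; rewrite color_contra // er0 r00 cats0.
(* As [r] ends with the other color, the first run of [r ++ w] lies within [r]. It is also the first
   run of [word G], whose last element is [u]; hence [u] occurs in [t]. *)
have [|||||eL _] := @color_prefix_uniq c (L ++ [:: u]) (L1 ++ word H2) L0 (r0 ++ w).
- by rewrite all_cat cL /= /has_color cu eqxx.
- by rewrite starts_cat.
- by [].
- by rewrite starts_cat.
- by rewrite (catA L0) -er0 eq_r -!catA.
have ut : u \in t by rewrite er er0 -eL !mem_cat inE eqxx !orbT.
have := sib u H1 H2 erefl; rewrite (negPf nH) /=.
by apply/negP; rewrite -leqNgt ltnW ?gt.
Qed.

(** A one-colored word reveals a leaf in first position. Otherwise the first run gives both [L] and
    [v], and only the end of the first block remains to be located: [block_end_leq], used in both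
    directions, shows that the two candidates have the same length. *)
Lemma word_inj c F G : valid_forest c F -> valid_forest c G ->
  word F = word G -> F = G.
Proof.
elim: F c G => [|v F1 IH1 F2 IH2] c G vF vG.
  by move/esym/eqP; rewrite word_nil; case: G vG.
case: G vG => [|v' G1 G2] vG; first by move/eqP; rewrite word_nil.
have [cv vF1 vF2 gtF sibF] := valid_node vF.
have [cv' vG1 vG2 gtG sibG] := valid_node vG.
case: (wordP vF) => [eF cF|t L neF eF cL nt st et];
  case: (wordP vG) => [eG cG|t' L' neG eG cL' nt' st' et'].
- by case=> -> /(IH2 _ _ vF2 vG2)->; rewrite eF eG.
- move=> eq_w; have := color_contra (c := c) nt'; rewrite et'.
  have : all (has_color c) ((L' ++ v' :: t') ++ word G2).
    by rewrite -eq_w /= cF andbT /has_color cv.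
  by rewrite !all_cat /= => /andP[/and3P[_ _ ->]] _ /(_ isT).
- move=> eq_w; have := color_contra (c := c) nt; rewrite et.
  have : all (has_color c) ((L ++ v :: t) ++ word F2).
    by rewrite eq_w /= cG andbT /has_color cv'.
  by rewrite !all_cat /= => /andP[/and3P[_ _ ->]] _ /(_ isT).
rewrite -!catA /= => eq_w.
have [|||||eL eq_t] := @color_prefix_uniq c (L ++ [:: v]) (t ++ word F2)
  (L' ++ [:: v']) (t' ++ word G2).
- by rewrite all_cat cL /= /has_color cv eqxx.
- by rewrite starts_cat.
- by rewrite all_cat cL' /= /has_color cv' eqxx.
- by rewrite starts_cat.
- by rewrite -!catA.
move: eL; rewrite !cats1 => /rcons_inj[eL ev]; subst L' v'.
have gt F' s s' : all (fun x => (red x == c) ==> (label v < label x)) (labels F') ->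
    word F' = s ++ s' -> {in s, forall x, red x = c -> label v < label x}.
  move=> gtF' eF' x xs cx; have := allP gtF' x.
  by rewrite -(perm_mem (perm_word F')) eF' mem_cat xs cx eqxx => /(_ isT).
have sib F' G' : ~~ is_empty F' -> sibling_ok v F' G' ->
    forall u H1 H2, G' = Node u H1 H2 -> is_empty H1 || (label u < label v).
  by move=> /negPf neF' + u H1 H2 eG'; rewrite eG' /= neF'.
have le1 := block_end_leq et (gt _ _ _ gtF eF) vG2 (sib _ _ neG sibG) eq_t.
have le2 := block_end_leq et' (gt _ _ _ gtG eG) vF2 (sib _ _ neF sibF) (esym eq_t).
move/eqP: eq_t; rewrite eqseq_cat; last by apply/eqP; rewrite eqn_leq le1.
case/andP=> /eqP tt' /eqP /(IH2 _ _ vF2 vG2) ->.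
by congr Node; apply: (IH1 _ _ vF1 vG1); rewrite eF eG tt'.
Qed.

(** * Decoding: cutting a word into blocks *)

Definition valid_word c s := starts c s && sorted run_rel s.

(** What may follow the block of [v]: a final run, to be read as leaves, or a first run that is not
    final and whose last element [u], the next root, is below [v]. *)
Definition low_start c v w : Prop := all (has_color c) w \/
  exists L u t, [/\ w = L ++ u :: t, all (has_color c) L, red u = c,
     starts (~~ c) t & label u < label v].

(** The scan takes a run of color [~~ c], then looks at the next run of color [c]. It stops before
    that run if it is final or goes below [v]; otherwise the run is absorbed into the block and the
    scan resumes after it. *)
Lemma cut_block c v s : s != [::] -> starts (~~ c) s -> sorted run_rel s ->
    {in s, forall x, red x = c -> label x != label v} ->
  exists t w, [/\ s = t ++ w, t != [::] /\ starts (~~ c) t, ends (~~ c) t,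
    {in t, forall x, red x = c -> label v < label x}
    & starts c w /\ low_start c v w].
Proof.
have [m] := ubnP (size s); elim: m s => // m IH s /ltnSE le_s ns ss so nv.
have [M [y [es cM sy]]] := split_color_prefix (~~ c) s; rewrite negbK in sy.
have nM : M != [::].
  apply: contraNneq ns => M0; move: ss; rewrite es M0 /=.
  by case: (y) sy => //= a y' /eqP->; case: (c).
have sM : starts (~~ c) M by rewrite es starts_cat in ss.
have eM := all_ends cM.
have gtM : {in M, forall x, red x = c -> label v < label x}.
  by move=> x /(allP cM)/eqP->; case: (c).
have [cy|ncy] := boolP (all (has_color c) y).
  by exists M, y; split=> //; split=> //; left.
have [L [z [ey cL sz]]] := split_color_prefix c y.
have nz : z != [::] by apply: contraNneq ncy => z0; rewrite ey z0 cats0.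
case/lastP: L => [|L u] in ey cL *.
  by case: (z) sz nz ey => //= a z' /eqP ca _ ey; rewrite ey /= ca in sy; case: (c) sy.
rewrite cat_rcons in ey; move: cL; rewrite all_rcons => /andP[/eqP cu cL].
have [_ soy] : sorted run_rel M /\ sorted run_rel y by apply: sorted_cat; rewrite -es.
have gtL : {in L, forall x, label u < label x}.
  by apply: (sorted_color_gt cL cu (t := z)); rewrite -ey.
(* Since runs decrease, [u] is the minimum of its run, so comparing it with [v] decides for the
   whole run. *)
have [luv|lvu] := ltnP (label u) (label v).
  by exists M, y; split=> //; split=> //; right; exists L, u, z.
have {}lvu : label v < label u.
  by rewrite ltn_neqAle eq_sym nv // es ey !mem_cat inE eqxx !orbT.
have soz : sorted run_rel z.
  by move: soy; rewrite ey => /sorted_cat[_ /path_sorted].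
have [|x xz|t [w [ez [nt st] et gtt lw]]] := IH z _ nz sz soz.
- by apply: leq_trans le_s; rewrite es ey !size_cat /= !addnS !ltnS addnA leq_addl.
- by apply: nv; rewrite es ey !mem_cat inE xz !orbT.
exists (M ++ L ++ u :: t), w; split=> //.
- by rewrite es ey ez -!catA.
- by rewrite starts_cat //; split=> //; rewrite -size_eq0 size_cat addn_eq0 size_eq0 (negPf nM).
- by rewrite catA ends_cat // -cat1s ends_cat.
move=> x; rewrite !mem_cat inE => /or4P[/gtM//|/gtL ux _|/eqP->//|/gtt//].
exact: ltn_trans ux.
Qed.

(** Induction on the length. A one-colored word is a list of leaves. Otherwise the first run is [L]
    followed by [v], [cut_block] splits the rest into [t] and [w], and the two shorter words
    [t ++ L] (for the subtrees of [v]) and [w] (for its later siblings) are decoded. *)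
Lemma word_surj c s : valid_word c s -> uniq s ->
    {in s &, forall x y, red x = red y -> label x = label y -> x = y} ->
  exists2 F, valid_forest c F & word F = s.
Proof.
have [m] := ubnP (size s); elim: m s c => // m IH s c /ltnSE le_s /andP[ss so] us inj.
have [cs|ncs] := boolP (all (has_color c) s).
  case: s => [|v s] /= in le_s ss so us inj cs *; first by exists Empty.
  have {cs} [cv cs] : red v == c /\ all (has_color c) s by apply/andP.
  have [|||F vF eF] := IH s c le_s.
  - by rewrite /valid_word all_starts //= (path_sorted so).
  - by case/andP: us.
  - by move=> x y xs ys; apply: inj; rewrite inE ?xs ?ys orbT.
  exists (Node v Empty F); last by rewrite /= eF.
  rewrite /= cv vF /=; case: F vF eF => // u H1 H2 vF eF.
  case: (wordP vF) eF => [-> _ eF|t L _ _ _ nt _ et eF]; last first.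
    by move: cs; rewrite -eF !all_cat /= => /andP[/and3P[_ _ ct] _]; rewrite (color_contra nt ct) in et.
  move: so cs; rewrite -eF /= => /andP[+ _] /andP[/eqP cu _].
  by rewrite /run_rel (eqP cv) cu eqxx.
have [L [z [es cL sz]]] := split_color_prefix c s.
have nz : z != [::] by apply: contraNneq ncs => z0; rewrite es z0 cats0.
case/lastP: L => [|L v] in es cL *.
  by case: (z) sz nz es => //= a z' /eqP ca _ ey; rewrite ey /= ca in ss; case: (c) ss.
rewrite cat_rcons in es; move: cL; rewrite all_rcons => /andP[/eqP cv cL].
have gtL : {in L, forall x, label v < label x}.
  by apply: (sorted_color_gt cL cv (t := z)); rewrite -es.
have [soL soz] : sorted run_rel L /\ sorted run_rel z.
  by rewrite es in so; have [? /path_sorted] := sorted_cat so.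
have vs : v \in s by rewrite es mem_cat inE eqxx orbT.
have [|t [w [ez [nt st] et gtt [sw lw]]]] := @cut_block c v z nz sz soz.
  move=> x xz cx; apply/eqP => lxv.
  have xv : x = v by apply: inj => //; rewrite ?cx // es mem_cat inE xz !orbT.
  by move: us; rewrite es cat_uniq /= -{2}xv xz !andbF.
have [sot sow] : sorted run_rel t /\ sorted run_rel w by apply: sorted_cat; rewrite -ez.
have sub1 : {subset t ++ L <= s}.
  by move=> x; rewrite es ez !(mem_cat, inE) => /orP[]->; rewrite ?orbT.
have sub2 : {subset w <= s}.
  by move=> x; rewrite es ez !(mem_cat, inE) => ->; rewrite ?orbT.
have us' : uniq (t ++ L) && uniq w.
  have : perm_eq s (v :: (t ++ L) ++ w).
    by rewrite es ez perm_catC /= perm_cons -!catA perm_cat2l perm_catC.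
  by move/perm_uniq; rewrite us => /esym /= /andP[_]; rewrite cat_uniq => /and3P[-> _ ->].
have [us1 us2] := andP us'.
have sz_s : size s = size L + (size t + size w).+1 by rewrite es ez size_cat /= size_cat.
have [||||G1 v1 e1] := IH (t ++ L) (~~ c).
- by rewrite size_cat; move: le_s; rewrite sz_s; clear; lia.
- by rewrite /valid_word starts_cat // st (sorted_cat_color (c := c)) ?sot // all_starts.
- by [].
- by move=> x y /sub1 xs /sub1 ys; apply: inj.
have [||||G2 v2 e2] := IH w c.
- by move: le_s; rewrite sz_s; clear; lia.
- by rewrite /valid_word sw.
- by [].
- by move=> x y /sub2 xs /sub2 ys; apply: inj.
have ne1 : ~~ is_empty G1 by rewrite -word_nil e1; case: (t) nt.
exists (Node v G1 G2); last by rewrite /= e1 e2 blockE ?cv // es ez -!catA.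
rewrite /= cv eqxx v1 v2 /=; apply/andP; split.
  apply/allP => x; rewrite -(perm_mem (perm_word G1)) e1 mem_cat.
  by case/orP=> [/gtt gx|/gtL->]; apply/implyP => // /eqP.
case: G2 v2 e2 => // u H1 H2 v2 e2; rewrite /sibling_ok (negPf ne1).
have [//|neH] := boolP (is_empty H1).
case: (wordP v2) e2 => [eH|t' L' _ _ cL' nt' st' et' e2]; first by rewrite eH in neH.
(* The next root [u] is not a leaf, so [w] is not a single run; comparing first runs then identifies
   [u] with the small element supplied by [low_start]. *)
case: lw => [|[L2 [u2 [t2 [ew cL2 cu2 st2 lt]]]]].
  by rewrite -e2 !all_cat /= => /andP[/and3P[_ _ ct] _]; rewrite (color_contra nt' ct) in et'.
have [cu _ _ _ _] := valid_node v2.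
have [|||||eL _] := @color_prefix_uniq c (L' ++ [:: u]) (t' ++ word H2) (L2 ++ [:: u2]) t2.
- by rewrite all_cat cL' /= /has_color cu eqxx.
- by rewrite starts_cat.
- by rewrite all_cat cL2 /= /has_color cu2 eqxx.
- by [].
- by rewrite -!catA /= -ew -e2 -catA.
by move: eL; rewrite !cats1 => /rcons_inj[_ ->].
Qed.


(** * Runs and left-to-right minima *)

Lemma runs_cons x s : exists r rs, runs (x :: s) = (x :: r) :: rs.
Proof.
rewrite /=; case: (runs s) => [|[|y r] rs]; try by exists [::], [::].
by case: ifP => _; do 2!eexists.
Qed.

Lemma runs_cat c s t : ends (~~ c) s -> starts c t -> runs (s ++ t) = runs s ++ runs t.
Proof.
case: s => // x s; rewrite ends_last => + st.
elim: s x => [|y s IH] x /=.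
  case: t st => //= y t /eqP cy; have [r [rs /= ->]] := runs_cons y t.
  by rewrite cy => /eqP->; case: c {cy}.
move/IH => /= ->; have [r [rs /= ->]] := runs_cons y s.
by rewrite /=; case: ifP.
Qed.

Lemma runs_color c s : s != [::] -> all (has_color c) s -> runs s = [:: s].
Proof.
case: s => // x s _; elim: s x => //= y s IH x /and3P[/eqP cx /eqP cy cs].
by rewrite (IH y) /= ?/has_color cy ?cx eqxx.
Qed.

Lemma decreasing_runs s : all (@decreasing n k) (runs s) = sorted run_rel s.
Proof.
elim: s => [|x [|y s] IH] //; have [r [rs e]] := runs_cons y s.
have -> : runs (x :: y :: s) =
    if red x == red y then (x :: y :: r) :: rs else [:: x] :: (y :: r) :: rs.
  by rewrite -e; move: e => /= ->.
rewrite -[RHS]/(run_rel x y && sorted run_rel (y :: s)) -IH e; case: ifP => exy.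
  by rewrite /decreasing /= /run_rel exy /= andbA.
by rewrite /decreasing /= /run_rel exy.
Qed.

(** Runs are consumed in pairs, so a final unpaired run, the possible [B_(l+1)], contributes
    nothing. *)
Fixpoint block_minima (rs : seq (seq V)) : seq nat :=
  if rs is B :: _ :: rs' then min_label B :: block_minima rs' else [::].

(** The bound [b] is the running minimum, which makes the number of records computable in one
    pass. *)
Fixpoint nb_minima b (l : seq nat) : nat :=
  if l is x :: l' then
    if x < b then (nb_minima x l').+1 else nb_minima b l'
  else 0.

Lemma two_step_ind T (P : seq T -> Prop) :
  P [::] -> (forall a : T, P [:: a]) ->
  (forall (a b : T) (r : seq T), P r -> P (a :: b :: r)) -> forall r : seq T, P r.
Proof.
move=> P0 P1 P2 r; suff [] : P r /\ forall a : T, P (a :: r) by [].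
by elim: r => [|b r [IH1 IH2]]; split=> // a; apply: P2.
Qed.

Lemma size_block_minima rs : size (block_minima rs) = (size rs)./2.
Proof. by elim/two_step_ind: rs => //= B R rs ->. Qed.

Lemma nth_block_minima rs i : i < (size rs)./2 ->
  nth 0 (block_minima rs) i = min_label (nth [::] rs i.*2).
Proof. by elim/two_step_ind: rs i => //= B R rs IH [|i] //= /IH. Qed.

Lemma card_nb_minima b l :
  #|[set i : 'I_(size l) | (nth 0 l i < b) &&
     [forall j : 'I_(size l), (j < i) ==> (nth 0 l i < nth 0 l j)]]| = nb_minima b l.
Proof.
rewrite -sum1_card; elim: l b => [|x l IH] b; first by rewrite big_pred0 // => -[].
rewrite [LHS]big_mkcond big_ord_recl /= inE.
have -> : [forall j : 'I_(size l).+1, (j < @ord0 (size l)) ==>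
    (nth 0 (x :: l) (@ord0 (size l)) < nth 0 (x :: l) j)] by apply/forallP.
(* For an index past the head, the comparison with the head is absorbed into the bound, which
   becomes [minn x b]. *)
have e (i : 'I_(size l)) : (lift ord0 i \in [set i : 'I_(size l).+1 | (nth 0 (x :: l) i < b) &&
    [forall j : 'I_(size l).+1, (j < i) ==> (nth 0 (x :: l) i < nth 0 (x :: l) j)]]) =
    (i \in [set i : 'I_(size l) | (nth 0 l i < minn x b) &&
      [forall j : 'I_(size l), (j < i) ==> (nth 0 l i < nth 0 l j)]]).
  rewrite !inE leq_min /= [RHS]andbC andbA andbC; congr (_ && _).
  apply/forallP/andP => [H|[/forallP H lx] j].
    split; last by have := H ord0.
    by apply/forallP=> j; have := H (lift ord0 j).
  have [j' ->|->] := unliftP ord0 j; last by rewrite /= lx.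
  exact: H.
under eq_bigr => i _ do rewrite e.
rewrite -big_mkcond /= IH andbT /minn.
case: ifP => // _; exact: add1n.
Qed.

Lemma leq_min_label m s : s != [::] -> (m <= min_label s) = all (fun x => m <= label x) s.
Proof.
case: s => // x s _ /=; elim: s => [|y s IH] /=; first by rewrite andbT.
by rewrite leq_min IH andbCA.
Qed.

Lemma min_label_leq s x : x \in s -> min_label s <= label x.
Proof.
move=> xs; have ns : s != [::] by case: (s) xs.
by have := leqnn (min_label s); rewrite leq_min_label // => /allP/(_ x xs).
Qed.

Lemma min_label_bound s : min_label s <= n + k.
Proof.
case: s => // x s; apply: leq_trans (min_label_leq (mem_head x s)) _.
case: x => i /=; have := ltn_ord i; lia.
Qed.

Lemma w_lrE (S : double_callan n k) :
  w_lr S = nb_minima (n + k).+1 (block_minima (runs (val S).1)).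
Proof.
rewrite /w_lr /nb_blocks; set s := bseqval _; rewrite -card_nb_minima.
have e := size_block_minima (runs s).
(* The length of [block_minima] occurs in the type of the indices; it is generalized to [m] so that
   it can be replaced. The bound [(n + k).+1] exceeds every label, so it excludes no index. *)
suff H m : m = (size (runs s))./2 ->
    #|[set i : 'I_((size (runs s))./2) | [forall j : 'I_((size (runs s))./2), (j < i) ==>
      (min_label (blue_run s i) < min_label (blue_run s j))]]| =
    #|[set i : 'I_m | (nth 0 (block_minima (runs s)) i < (n + k).+1) &&
     [forall j : 'I_m, (j < i) ==> (nth 0 (block_minima (runs s)) i <
       nth 0 (block_minima (runs s)) j)]]| by exact: H.
move=> ->; apply: eq_card => i; rewrite !inE nth_block_minima // ltnS min_label_bound /=.
by apply: eq_forallb => j; rewrite nth_block_minima.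
Qed.

(** Inside a block, after its first run [B], the runs of color [c] have minima above [v] and so set
    no new record. As [t] starts and ends with color [~~ c], it has an odd number of runs: with [B]
    they pair up, and [rs] is again read from a run in odd position. *)
Lemma block_minima_tail c v t B rs : t != [::] -> starts (~~ c) t -> ends (~~ c) t ->
    {in t, forall x, red x = c -> label v < label x} ->
  exists2 l, all (fun m => label v < m) l &
    block_minima (B :: runs t ++ rs) = min_label B :: l ++ block_minima rs.
Proof.
have [m] := ubnP (size t); elim: m t B => // m IH t B /ltnSE le_t nt st et gt.
have [R [y [ey cR]]] := split_color_prefix (~~ c) t; rewrite negbK => sy.
have nR : R != [::].
  apply: contraNneq nt => R0; move: st; rewrite ey R0 /=.
  by case: (y) sy => //= a y' /eqP->; case: (c).
have eR := all_ends cR.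
have [y0|ny] := eqVneq y [::].
  by exists [::] => //; rewrite ey y0 cats0 (runs_color nR cR).
have [L [z [ez cL sz]]] := split_color_prefix c y.
have nL : L != [::].
  apply: contraNneq ny => L0; move: sy; rewrite ez L0 /=.
  by case: (z) sz => //= a y' /eqP->; case: (c).
have nz : z != [::].
  apply: contraTneq et => z0; rewrite ey ez z0 cats0 ends_cat //.
  by rewrite (color_contra nL cL).
have eL : ends (~~ ~~ c) L by rewrite negbK all_ends.
have [|||l gtl el] := IH z L _ nz sz.
- apply: leq_trans le_t; rewrite ey ez !size_cat.
  by rewrite addnA -[X in X < _]add0n ltn_add2r addn_gt0 lt0n size_eq0 nR.
- by move: et; rewrite ey ez catA ends_cat.
- by move=> x xz; apply: gt; rewrite ey ez !mem_cat xz !orbT.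
exists (min_label L :: l).
  rewrite /= gtl andbT leq_min_label //; apply/allP => x xL.
  by apply: gt; rewrite ?ey ?ez ?mem_cat ?xL ?orbT // (eqP (allP cL _ xL)).
rewrite ey (runs_cat eR sy) (runs_color nR cR) ez (runs_cat eL sz) (runs_color nL cL).
by rewrite -[LHS]/(min_label B :: block_minima (L :: runs z ++ rs)) el.
Qed.

(** The first run of the block of a non-leaf [v] has minimum [v], which is a record because non-leaf
    siblings decrease; the rest of the block sets none. Once the leaves begin, what is left is one
    unpaired run, which counts for 0. *)
Lemma nb_minima_word c b F : valid_forest c F ->
    (forall v G1 G2, F = Node v G1 G2 -> is_empty G1 || (label v < b)) ->
  nb_minima b (block_minima (runs (word F))) = nb_nonleaf F.
Proof.
elim: F b => [|v G1 _ G2 IH] b vF vb //; have [cv v1 v2 gtv sib] := valid_node vF.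
case: (wordP vF) => [e1 c2|t L ne1 e1 cL nt st et].
  have c2' : all (has_color c) (v :: word G2) by rewrite /= c2 /has_color cv eqxx.
  rewrite (runs_color _ c2') // e1 /= -(IH b v2); last first.
    move=> u H1 H2 eG; move: sib; rewrite eG e1 /= => /andP[->]//.
  by have [->//|ne] := eqVneq (word G2) [::]; rewrite (runs_color ne c2).
have gt x : x \in t ++ L -> red x = c -> label v < label x.
  by rewrite -e1 (perm_mem (perm_word G1)) => /(allP gtv) + cx; rewrite cx eqxx.
have -> : (L ++ v :: t) ++ word G2 = rcons L v ++ (t ++ word G2) by rewrite cat_rcons -catA.
have st2 := valid_word_starts v2.
have cLv : all (has_color c) (rcons L v) by rewrite all_rcons cL /has_color cv eqxx.
rewrite (runs_cat (c := ~~ c)) ?starts_cat // ?negbK ?all_ends //.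
rewrite (runs_cat et st2) (runs_color _ cLv) ?cat1s; last by case: (L).
have gtt : {in t, forall x, red x = c -> label v < label x}.
  by move=> x xt; apply: gt; rewrite mem_cat xt.
have [l gtl ->] := block_minima_tail (rcons L v) (runs (word G2)) nt st et gtt.
have -> : min_label (rcons L v) = label v.
  apply/eqP; rewrite eqn_leq min_label_leq ?mem_rcons ?mem_head //=.
  rewrite leq_min_label; last by case: (L).
  rewrite all_rcons leqnn; apply/allP => x xL.
  by rewrite ltnW // gt ?mem_cat ?xL ?orbT // (eqP (allP cL _ xL)).
have := vb v G1 G2 erefl; rewrite (negPf ne1) /= => ->.
rewrite ne1 add1n; congr _.+1.
rewrite -(IH (label v) v2); last first.
  by move=> u H1 H2 eG; move: sib; rewrite eG /= (negPf ne1).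
elim: l gtl => //= x l IHl /andP[vx /IHl <-].
by rewrite ltnNge ltnW.
Qed.

End Words.

(** * Parent maps and the forests that they define *)

Section ParentMaps.
Variables n k : nat.
Local Notation V := (symbol n k).
Implicit Types (s l : seq V) (u v x y r : V) (c : bool) (F G : forest V).
Implicit Types p q : {ffun V -> V}.

Lemma symbol_inj x y : red x = red y -> label x = label y -> x = y.
Proof. by case: x y => [x|x] [y|y] //= _ /val_inj->. Qed.

Lemma label0P x : label x = 0 -> x = if red x then red0 n k else blue0 n k.
Proof. by case: x => x /= x0; congr (_ _); apply: val_inj. Qed.

Lemma label_bound x : label x <= n + k.
Proof. by case: x => i /=; have := ltn_ord i; lia. Qed.

(* A pair of double alternative trees, seen through its parent function: the
   roots are fixed points, and the label condition only needs to be checked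
   between a vertex and its grandparent. *)
Definition is_parent_map p : bool :=
  [forall v, if label v == 0 then p v == v
             else (red (p v) != red v) && (label (p (p v)) < label v)].

Definition has_child p u : bool := [exists v, (label v != 0) && (p v == u)].

Definition sib_lt p : rel V := fun v u =>
  if has_child p v then ~~ has_child p u || (label u < label v)
  else ~~ has_child p u && (label u < label v).

(** The total version, needed by [sort]; the strict [sib_lt] is what determines a sorted list from
    its set of elements. *)
Definition sib_le p : rel V := fun v u =>
  if has_child p v then ~~ has_child p u || (label u <= label v)
  else ~~ has_child p u && (label u <= label v).

Definition child_seq p u : seq V :=
  sort (sib_le p) (enum [pred v | (label v != 0) && (p v == u)]).

Lemma mem_child_seq p u v : (v \in child_seq p u) = (label v != 0) && (p v == u).
Proof. by rewrite mem_sort mem_enum. Qed.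

Lemma child_seq_uniq p u : uniq (child_seq p u).
Proof. by rewrite sort_uniq enum_uniq. Qed.

Lemma has_childE p u : has_child p u = ~~ nilp (child_seq p u).
Proof.
apply/existsP/idP => [[v]|]; first by rewrite -mem_child_seq; case: child_seq.
case e: (child_seq p u) => [|v l] // _; exists v.
by rewrite -mem_child_seq e mem_head.
Qed.

Lemma sib_lt_trans p : transitive (sib_lt p).
Proof. by move=> y x z; rewrite /sib_lt; do 3!case: has_child => //=; lia. Qed.

Lemma sib_lt_irr p : irreflexive (sib_lt p).
Proof. by move=> x; rewrite /sib_lt ltnn; case: has_child. Qed.

Section Valid.
Variable p : {ffun V -> V}.
Hypothesis vp : is_parent_map p.

Lemma parent_zero v : label v = 0 -> p v = v.
Proof. by move=> v0; have /forallP/(_ v) := vp; rewrite v0 /= => /eqP. Qed.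

Lemma parent_color v : label v != 0 -> red (p v) = ~~ red v.
Proof.
move=> v0; have /forallP/(_ v) := vp; rewrite (negPf v0) => /andP[+ _].
by case: (red v) (red (p v)) => [] [].
Qed.

Lemma grandparent_lt v : label v != 0 -> label (p (p v)) < label v.
Proof. by move=> v0; have /forallP/(_ v) := vp; rewrite (negPf v0) => /andP[]. Qed.

(** Sorting gives only [sib_le]. Distinct children of [u] share the color opposite to that of [u],
    so their labels differ and the order is strict. *)
Lemma child_seq_sorted u : sorted (sib_lt p) (child_seq p u).
Proof.
have le_tr : transitive (sib_le p).
  by move=> y x z; rewrite /sib_le; do 3!case: has_child => //=; lia.
have le_tot : total (sib_le p).
  by move=> x y; rewrite /sib_le; do 2!case: has_child => //=; lia.
have := sort_sorted le_tot (enum [pred v | (label v != 0) && (p v == u)]).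
rewrite -/(child_seq p u) !sorted_pairwise //; last exact: sib_lt_trans.
move=> le_p; have := child_seq_uniq p u; rewrite uniq_pairwise => ne_p.
have : pairwise [rel x y | sib_le p x y && (x != y)] (child_seq p u).
  by rewrite pairwise_relI le_p.
apply: sub_in_pairwise (allss _) => x y; rewrite !mem_child_seq.
move=> /andP[x0 /eqP px] /andP[y0 /eqP py] /= /andP[le_xy ne_xy].
have {}ne_xy : label y != label x.
  apply: contraNneq ne_xy => e; apply/eqP/symbol_inj => //.
  by apply: (inv_inj negbK); rewrite -!parent_color // px py.
by move: le_xy; rewrite /sib_le /sib_lt (ltn_neqAle (label y)) ne_xy.
Qed.

(** The label alone need not decrease from a vertex to its parent, which has the other color.
    Passing to the parent replaces [label v] in this sum by the smaller label of the grandparent, so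
    this is a measure for climbing the tree. *)
Definition rank v := label v + label (p v).

Lemma rank_parent v : label v != 0 -> rank (p v) < rank v.
Proof. by move=> v0; rewrite /rank addnC ltn_add2r grandparent_lt. Qed.

End Valid.

Fixpoint coherent p F : bool :=
  if F is Node v G1 G2 then
    [&& root_seq G1 == child_seq p v, coherent p G1 & coherent p G2]
  else true.

Definition represents p (F : forest V * forest V) : bool :=
  [&& root_seq F.1 == child_seq p (red0 n k), root_seq F.2 == child_seq p (blue0 n k),
      coherent p F.1 & coherent p F.2].

Lemma coherent_exists p u : is_parent_map p ->
  exists2 F, root_seq F = child_seq p u & coherent p F.
Proof.
(* The construction descends from [u] to its children, where [rank] increases; as a sum of two
   labels it is at most twice [n + k]. *)
move=> vp; have [m] := ubnP ((n + k).*2.+1 - rank p u).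
elim: m u => // m IH u /ltnSE le_m.
have : {subset child_seq p u <= child_seq p u} by [].
elim: {1 3}(child_seq p u) => [|v l IHl] sub; first by exists Empty.
have [x xl|G2 r2 c2] := IHl; first by apply: sub; rewrite inE xl orbT.
have [|G1 r1 c1] := IH v.
  have := sub v (mem_head _ _); rewrite mem_child_seq => /andP[v0 /eqP pv].
  have := rank_parent vp v0; rewrite pv.
  by have := label_bound v; have := label_bound (p v); rewrite /rank in le_m *; lia.
by exists (Node v G1 G2); rewrite /= ?r2 // r1 eqxx c1.
Qed.

Lemma coherent_uniq p F G : coherent p F -> coherent p G -> root_seq F = root_seq G -> F = G.
Proof.
elim: F G => [|v F1 IH1 F2 IH2] [|v' G1 G2] //=.
move=> /and3P[/eqP r1 c1 c2] /and3P[/eqP r1' c1' c2'] [ev /(IH2 _ c2 c2')->].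
by subst v'; rewrite (IH1 G1) // r1.
Qed.

Lemma coherent_determines p q F x : coherent p F -> coherent q F ->
  x \in labels F -> x \notin root_seq F -> p x = q x.
Proof.
elim: F => //= v F1 IH1 F2 IH2 /and3P[/eqP r1 c1 c2] /and3P[/eqP r1' c1' c2'].
rewrite !inE mem_cat negb_or => /orP[->//|/orP[x1|x2]] /andP[_ nx2]; last exact: IH2.
have [xr|nxr] := boolP (x \in root_seq F1); last exact: IH1.
have := xr; rewrite r1 mem_child_seq => /andP[_ /eqP->].
by move: xr; rewrite r1' mem_child_seq => /andP[_ /eqP->].
Qed.

Lemma coherent_label p F x : coherent p F -> x \in labels F ->
  x \in root_seq F \/ label x != 0 /\ p x \in labels F.
Proof.
elim: F => //= v F1 IH1 F2 IH2 /and3P[/eqP r1 c1 c2].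
rewrite !inE mem_cat => /orP[->|/orP[x1|x2]]; first by left.
  have [|[? px]] := IH1 c1 x1; last by right; rewrite mem_cat px !orbT.
  by rewrite r1 mem_child_seq => /andP[? /eqP->]; right; rewrite eqxx.
have [->|[? px]] := IH2 c2 x2; first by left; rewrite orbT.
by right; rewrite mem_cat px !orbT.
Qed.

Lemma coherent_nonzero p F : coherent p F -> all (fun x => label x != 0) (root_seq F) ->
  all (fun x => label x != 0) (labels F).
Proof.
move=> cF /allP nzr; apply/allP => x /(coherent_label cF)[/nzr//|[]//].
Qed.

Lemma child_seq_nonzero p u : all (fun x => label x != 0) (child_seq p u).
Proof. by apply/allP => x; rewrite mem_child_seq => /andP[]. Qed.

(** The local condition is propagated by climbing two levels at a time: the grandparent of [x] has
    the same color and a smaller label, and either it is [v] or it still lies in [F]. *)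
Lemma coherent_label_lt p F v x : is_parent_map p -> coherent p F ->
  root_seq F = child_seq p v -> x \in labels F -> red x = red v -> label v < label x.
Proof.
move=> vp cF rF; have [m] := ubnP (label x); elim: m x => // m IH x /ltnSE le_m xF cx.
have nr y : y \in root_seq F -> red y = ~~ red v.
  rewrite rF mem_child_seq => /andP[y0 /eqP<-].
  by rewrite parent_color // negbK.
have [/nr|[x0 pxF]] := coherent_label cF xF; first by rewrite cx; case: (red v).
have lt_x := grandparent_lt vp x0; have cpx := parent_color vp x0.
have [|[px0 ppxF]] := coherent_label cF pxF.
  by rewrite rF mem_child_seq => /andP[_ /eqP e]; rewrite -e.
apply: ltn_trans (lt_x); apply: IH => //; first exact: leq_trans lt_x le_m.
by rewrite parent_color // cpx negbK.
Qed.

Lemma coherent_valid p F c : is_parent_map p -> coherent p F ->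
    sorted (sib_lt p) (root_seq F) -> all (has_color c) (root_seq F) ->
  valid_forest c F.
Proof.
move=> vp; elim: F c => //= v F1 IH1 F2 IH2 c /and3P[/eqP r1 c1 c2] so /andP[cv cr].
have cv' : red v = c by apply/eqP.
apply/and5P; split=> //.
- apply: IH1; rewrite ?r1 ?child_seq_sorted //; apply/allP => x.
  by rewrite mem_child_seq -cv' => /andP[x0 /eqP<-]; rewrite parent_color // negbK /has_color.
- by apply: IH2 => //; apply: path_sorted so.
- apply/allP => x x1; apply/implyP => /eqP cx.
  by apply: coherent_label_lt r1 x1 _ => //; rewrite cx.
case: F2 c2 so {IH2 cr} => //= u H1 H2 /and3P[/eqP r2 _ _] /andP[+ _].
rewrite /sib_lt !has_childE -r1 -r2 -!is_emptyE !negbK.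
by case: (is_empty F1).
Qed.

Lemma represents_valid p (F : forest V * forest V) : is_parent_map p -> represents p F ->
  valid_forest false F.1 /\ valid_forest true F.2.
Proof.
move=> vp /and4P[/eqP r1 /eqP r2 c1 c2]; split; apply: (coherent_valid vp) => //;
  rewrite ?r1 ?r2 ?child_seq_sorted //; apply/allP => x;
  by rewrite mem_child_seq /has_color => /andP[x0 /eqP e];
    have := parent_color vp x0; rewrite e; case: (red x).
Qed.

(** An occurrence of [x] is either at top level or directly below an occurrence of its parent, and
    each occurrence of the parent has [x] below it exactly once. *)
Lemma count_coherent p F x : label x != 0 -> coherent p F ->
  count_mem x (labels F) = count_mem x (root_seq F) + count_mem (p x) (labels F).
Proof.
move=> x0; elim: F => //= v F1 IH1 F2 IH2 /and3P[/eqP r1 /IH1 c1 /IH2 c2].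
rewrite !count_cat c1 c2 r1 count_uniq_mem ?child_seq_uniq // mem_child_seq x0 /=.
by rewrite [p x == v]eq_sym addnACA [(v == p x) + _]addnC -!addnA.
Qed.

Lemma perm_labels p (F : forest V * forest V) : is_parent_map p -> represents p F ->
  perm_eq (labels F.1 ++ labels F.2) [seq v <- enum V | label v != 0].
Proof.
move=> vp /and4P[/eqP r1 /eqP r2 c1 c2].
have ct0 x : label x = 0 -> count_mem x (labels F.1 ++ labels F.2) = 0.
  move=> x0; apply/count_memPn; apply/negP.
  have := coherent_nonzero c1; have := coherent_nonzero c2.
  rewrite r1 r2 !child_seq_nonzero => /(_ isT)/allP nz2 /(_ isT)/allP nz1.
  by rewrite mem_cat => /orP[/nz1|/nz2]; rewrite x0.
have ct x : count_mem x (labels F.1 ++ labels F.2) = (label x != 0).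
  have [m] := ubnP (rank p x); elim: m x => // m IH x /ltnSE le_m.
  have [/ct0//|x0] := eqVneq (label x) 0.
  rewrite count_cat (count_coherent x0 c1) (count_coherent x0 c2) addnACA -(count_cat _ (labels F.1)) r1 r2.
  rewrite !(count_uniq_mem _ (child_seq_uniq _ _)) !mem_child_seq x0 /=.
  rewrite IH; last exact: leq_trans (rank_parent vp x0) le_m.
  (* Exactly one source contributes 1: if [p x] is one of the two roots, [x] is at top level of one
     forest and [p x] occurs in neither; otherwise only the single occurrence of [p x] counts. *)
  have [/label0P e|px0] := eqVneq (label (p x)) 0.
    by case: (red (p x)) e => ->.
  have ne r : label r = 0 -> (p x == r) = false.
    by move=> r0; apply: contraNF px0 => /eqP->; rewrite r0.
  by rewrite !ne.
apply: uniq_perm; last 1 first.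
- by move=> x; rewrite mem_filter mem_enum andbT -has_pred1 has_count ct; case: eqP.
- by apply/count_mem_uniq => x; rewrite ct -has_pred1 has_count ct; case: eqP.
- by rewrite filter_uniq ?enum_uniq.
Qed.

Lemma represents_exists p : is_parent_map p ->
  exists F : forest V * forest V, represents p F.
Proof.
move=> vp; have [F1 r1 c1] := coherent_exists (red0 n k) vp.
have [F2 r2 c2] := coherent_exists (blue0 n k) vp.
by exists (F1, F2); rewrite /represents r1 r2 c1 c2 !eqxx.
Qed.

Lemma represents_uniq p (F G : forest V * forest V) : represents p F -> represents p G -> F = G.
Proof.
case: F G => [F1 F2] [G1 G2] /and4P[/= /eqP r1 /eqP r2 c1 c2] /and4P[/= /eqP s1 /eqP s2 d1 d2].
have -> : F1 = G1 by apply: coherent_uniq c1 d1 _; rewrite r1.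
by have -> : F2 = G2 by apply: coherent_uniq c2 d2 _; rewrite r2.
Qed.

Lemma represents_inj p q (F : forest V * forest V) : is_parent_map p -> is_parent_map q ->
  represents p F -> represents q F -> p = q.
Proof.
move=> vp vq rp rq; apply/ffunP => x.
have [x0|x0] := eqVneq (label x) 0; first by rewrite !parent_zero.
have := perm_mem (perm_labels vp rp) x; rewrite mem_cat mem_filter mem_enum x0 /=.
case/and4P: rp rq => /eqP r1 /eqP r2 c1 c2 /and4P[/eqP s1 /eqP s2 d1 d2].
case/orP=> xF.
  have [xr|nxr] := boolP (x \in root_seq F.1); last exact: coherent_determines xF nxr.
  have := xr; rewrite r1 mem_child_seq => /andP[_ /eqP->].
  by move: xr; rewrite s1 mem_child_seq => /andP[_ /eqP->].
have [xr|nxr] := boolP (x \in root_seq F.2); last exact: coherent_determines xF nxr.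
have := xr; rewrite r2 mem_child_seq => /andP[_ /eqP->].
by move: xr; rewrite s2 mem_child_seq => /andP[_ /eqP->].
Qed.

Lemma nb_nonleafE p F u : coherent p F -> root_seq F = child_seq p u ->
  nb_nonleaf F = #|[set v | [&& label v != 0, p v == u & has_child p v]]|.
Proof.
move=> cF rF; transitivity (count (has_child p) (root_seq F)).
  elim: F cF {rF} => //= v F1 _ F2 IH /and3P[/eqP r1 _ /IH->].
  by rewrite has_childE -r1 is_emptyE.
rewrite rF -size_filter -(card_uniqP _) ?filter_uniq ?child_seq_uniq //.
by apply: eq_card => v; rewrite inE mem_filter mem_child_seq andbC -andbA.
Qed.

(** * Recovering a parent map from a pair of forests *)

Fixpoint parent_in r F v : V :=
  if F is Node u G1 G2 then
    if v == u then r else if v \in labels G1 then parent_in u G1 v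
    else parent_in r G2 v
  else r.

Definition agrees p r F := {in labels F, forall v, p v = parent_in r F v}.

Lemma agrees_node p r u G1 G2 : uniq (labels (Node u G1 G2)) ->
  agrees p r (Node u G1 G2) -> [/\ p u = r, agrees p u G1 & agrees p r G2].
Proof.
rewrite /= mem_cat negb_or cat_uniq => /and4P[/andP[u1 u2] _ /hasPn d12 _] ag; split.
- by rewrite ag /= ?eqxx ?mem_head.
- move=> v v1; rewrite ag /= ?inE ?mem_cat ?v1 ?orbT //.
  by case: eqP => // e; rewrite -e v1 in u1.
move=> v v2; rewrite ag /= ?inE ?mem_cat ?v2 ?orbT // (negPf (d12 v v2)).
by case: eqP => // e; rewrite -e v2 in u2.
Qed.

Lemma parent_in_mem r F v : parent_in r F v \in r :: labels F.
Proof.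
elim: F r => [|u G1 IH1 G2 IH2] r /=; first by rewrite mem_head.
case: eqP => _; first by rewrite mem_head.
case: ifP => _; last by have := IH2 r; rewrite !inE mem_cat => /orP[]->; rewrite ?orbT.
by have := IH1 u; rewrite !inE mem_cat => /orP[]->; rewrite ?orbT.
Qed.

Lemma parent_in_color c r F v : valid_forest c F -> red r = ~~ c ->
  v \in labels F -> red (parent_in r F v) != red v.
Proof.
elim: F c r => // u G1 IH1 G2 IH2 c r /valid_node[cu v1 v2 _ _] cr /=.
rewrite inE mem_cat; case: eqP => [-> _|_ /=]; first by rewrite cu cr; case: (c).
case: ifP => [x1 _|_ /= x2]; last exact: IH2 v2 cr x2.
by apply: IH1 v1 _ x1; rewrite negbK.
Qed.

Lemma valid_root_seq c F : valid_forest c F -> all (has_color c) (root_seq F).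
Proof.
by elim: F => // v F1 _ F2 IH /valid_node[/eqP cv _ /IH rF _ _]; apply/andP.
Qed.

Lemma root_seq_labels F : {subset root_seq F <= labels F}.
Proof.
elim: F => //= v F1 _ F2 IH x; rewrite !inE mem_cat => /predU1P[->|/IH->].
  by rewrite eqxx.
by rewrite !orbT.
Qed.

(** The last two hypotheses describe the vertex [r] above the forest: the first settles the roots,
    whose grandparent is [p r]; the second becomes the first when the induction enters the subtrees
    of a root. *)
Lemma agrees_grandparent p c r F : valid_forest c F -> uniq (labels F) ->
    agrees p r F -> {in root_seq F, forall v, label (p r) < label v} ->
    {in labels F, forall v, red v = ~~ c -> label r < label v} ->
  {in labels F, forall v, label (p (p v)) < label v}.
Proof.
elim: F c r => // u G1 IH1 G2 IH2 c r vF uF ag gtr gtl.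
have [cu v1 v2 gtu _] := valid_node vF; have [pu ag1 ag2] := agrees_node uF ag.
move: uF; rewrite /= cat_uniq => /and4P[_ u1 _ u2] v.
rewrite inE mem_cat => /or3P[/eqP->|v1l|v2l].
- by rewrite pu gtr ?mem_head.
- have cr := allP (valid_root_seq v1).
  apply: IH1 v1 u1 ag1 _ _ v v1l => x xG.
    rewrite pu; apply: gtl; last by apply/eqP/cr.
    by rewrite inE mem_cat root_seq_labels ?orbT.
  by rewrite negbK => cx; have := allP gtu x xG; rewrite cx eqxx.
apply: IH2 v2 u2 ag2 _ _ v v2l => x xG; first by apply: gtr; rewrite inE xG orbT.
by apply: gtl; rewrite inE mem_cat xG !orbT.
Qed.


(** Coherence up to the order of siblings. The order in [child_seq] depends on which vertices have
    children for [p], so the sets of children have to be known before the order can be compared. *)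
Fixpoint weakly_coherent p F : Prop :=
  if F is Node u G1 G2 then
    [/\ forall v, (v \in root_seq G1) = (label v != 0) && (p v == u),
        weakly_coherent p G1 & weakly_coherent p G2]
  else True.

(** The last hypothesis says that no symbol outside [F] has its parent in [F]; without it [p] could
    give a vertex of [F] additional children. The induction must restore it for both subforests. *)
Lemma agrees_coherent p r F : uniq (r :: labels F) ->
    all (fun v => label v != 0) (labels F) -> agrees p r F ->
    (forall v, label v != 0 -> v \notin labels F -> p v \notin labels F) ->
  weakly_coherent p F /\ {in labels F, forall v, (v \in root_seq F) = (p v == r)}.
Proof.
elim: F r => // u G1 IH1 G2 IH2 r uF nz ag out.
have [pu ag1 ag2] := agrees_node (proj2 (andP uF)) ag.
have mem1 v : v \in labels G1 -> p v \in u :: labels G1 by move/ag1->; apply: parent_in_mem.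
have mem2 v : v \in labels G2 -> p v \in r :: labels G2 by move/ag2->; apply: parent_in_mem.
move: uF nz; rewrite /= inE mem_cat !negb_or all_cat cat_uniq.
case/and3P=> /and3P[ru r1 r2]; rewrite mem_cat negb_or => /andP[u1 u2].
case/and3P=> uq1 /hasPn d12 uq2 /and3P[u0 nz1 nz2].
have out1 v : label v != 0 -> v \notin labels G1 -> p v \notin labels G1.
  move=> v0 v1; have [->|vu] := eqVneq v u; first by rewrite pu.
  have [v2|v2] := boolP (v \in labels G2).
    have := mem2 v v2; rewrite inE => /predU1P[->//|pv2].
    exact: d12.
  have := out v v0; rewrite /= !inE !mem_cat !negb_or vu v1 v2.
  by case/(_ isT)/and3P.
have out2 v : label v != 0 -> v \notin labels G2 -> p v \notin labels G2.
  move=> v0 v2; have [->|vu] := eqVneq v u; first by rewrite pu.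
  have [v1|v1] := boolP (v \in labels G1).
    have := mem1 v v1; rewrite inE => /predU1P[->//|pv1].
    by apply: contraL pv1 => /d12.
  have := out v v0; rewrite /= !inE !mem_cat !negb_or vu v1 v2.
  by case/(_ isT)/and3P.
have [wc1 rt1] := IH1 u (introT andP (conj u1 uq1)) nz1 ag1 out1.
have [wc2 rt2] := IH2 r (introT andP (conj r2 uq2)) nz2 ag2 out2.
split.
  split=> // v; apply/idP/andP => [vr|[v0 /eqP pv]].
    have v1 := root_seq_labels vr; rewrite -rt1 // vr; split=> //.
    exact: (allP nz1).
  have [v1|v1] := boolP (v \in labels G1); first by rewrite rt1 // pv.
  have vu : v != u by apply: contraNneq ru => vu; rewrite -pu -{1}vu pv.
  have [v2|v2] := boolP (v \in labels G2).
    have := mem2 v v2; rewrite pv inE => /predU1P[ur|uG]; first by rewrite ur eqxx in ru.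
    by rewrite uG in u2.
  have := out v v0; rewrite /= !inE !mem_cat !negb_or vu v1 v2 pv eqxx.
  by case/(_ isT)/and3P.
move=> v; rewrite !inE mem_cat => /or3P[/eqP->|v1|v2].
- by rewrite pu !eqxx.
- have [vu|vu] := eqVneq v u; first by rewrite -vu v1 in u1.
  rewrite /=; apply/idP/eqP => [/root_seq_labels/d12|pv]; first by rewrite v1.
  have := mem1 v v1; rewrite pv inE => /predU1P[ur|rG]; first by rewrite ur eqxx in ru.
  by rewrite rG in r1.
have [vu|vu] := eqVneq v u; first by rewrite -vu v2 in u2.
exact: rt2.
Qed.

Lemma weakly_coherent_sorted p c F : weakly_coherent p F -> valid_forest c F ->
  sorted (sib_lt p) (root_seq F).
Proof.
have hc u H1 H2 : weakly_coherent p (Node u H1 H2) -> has_child p u = ~~ is_empty H1.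
  case=> r1 _ _; rewrite is_emptyE; apply/existsP/idP => [[v]|].
    by rewrite -r1; case: root_seq.
  case e: (root_seq H1) => [|v l] // _; exists v.
  by rewrite -r1 e mem_head.
elim: F => // v F1 _ F2 IH wF /valid_node[_ _ v2 _ sib].
have [_ _ w2] := wF; case: F2 sib v2 w2 {wF} (hc _ _ _ wF) IH => // u H1 H2.
move=> sib v2 w2 hv IH; apply/andP; split; last exact: IH w2 v2.
move: sib; rewrite /sib_lt hv (hc _ _ _ w2) /= negbK.
by case: is_empty.
Qed.

Lemma weakly_coherent_coherent p c F : weakly_coherent p F -> valid_forest c F ->
  is_parent_map p -> coherent p F.
Proof.
move=> + + vp; elim: F c => //= v F1 IH1 F2 IH2 c [r1 w1 w2] /valid_node[_ v1 v2 _ _].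
rewrite (IH1 _ w1 v1) (IH2 _ w2 v2) !andbT; apply/eqP.
apply: (irr_sorted_eq (@sib_lt_trans p) (@sib_lt_irr p)).
- exact: weakly_coherent_sorted w1 v1.
- exact: child_seq_sorted.
- by move=> x; rewrite r1 mem_child_seq.
Qed.

Lemma represents_surj (F : forest V * forest V) :
    valid_forest false F.1 -> valid_forest true F.2 ->
    perm_eq (labels F.1 ++ labels F.2) [seq v <- enum V | label v != 0] ->
  exists2 p, is_parent_map p & represents p F.
Proof.
case: F => F1 F2 /= v1 v2 pF.
have memF v : (label v != 0) = (v \in labels F1) || (v \in labels F2).
  by rewrite -mem_cat (perm_mem pF) mem_filter mem_enum andbT.
have : uniq (labels F1 ++ labels F2).
  by rewrite (perm_uniq pF) filter_uniq ?enum_uniq.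
rewrite cat_uniq => /and3P[u1 /hasPn d12 u2].
pose p : {ffun V -> V} := [ffun v => if label v == 0 then v else
  if v \in labels F1 then parent_in (red0 n k) F1 v else parent_in (blue0 n k) F2 v].
have p0 v : label v = 0 -> p v = v by move=> v0; rewrite ffunE v0.
have a1 : agrees p (red0 n k) F1.
  by move=> v vF; rewrite ffunE -[label v == 0]negbK memF vF.
have a2 : agrees p (blue0 n k) F2.
  by move=> v vF; rewrite ffunE -[label v == 0]negbK memF vF orbT /= (negPf (d12 v vF)).
have nz1 v : v \in labels F1 -> label v != 0 by rewrite memF => ->.
have nz2 v : v \in labels F2 -> label v != 0 by rewrite memF orbC => ->.
have vp : is_parent_map p.
  apply/forallP => v; case: eqP => [/p0->//|/eqP v0].
  have := v0; rewrite memF => /orP[vF|vF]; apply/andP; split.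
  - by rewrite a1 //; apply: parent_in_color v1 _ vF.
  (* The root is its own parent and has label 0, so both conditions at the root reduce to labels
     being nonzero. *)
  - apply: (agrees_grandparent v1 u1 a1) => // x xF; rewrite ?p0 // lt0n nz1 //.
    exact: root_seq_labels.
  - by rewrite a2 //; apply: parent_in_color v2 _ vF.
  - apply: (agrees_grandparent v2 u2 a2) => // x xF; rewrite ?p0 // lt0n nz2 //.
    exact: root_seq_labels.
have par1 v : v \in labels F1 -> p v \in red0 n k :: labels F1.
  by move/a1->; apply: parent_in_mem.
have par2 v : v \in labels F2 -> p v \in blue0 n k :: labels F2.
  by move/a2->; apply: parent_in_mem.
have z1 : red0 n k \notin labels F1 by apply/negP => /nz1.
have z2 : blue0 n k \notin labels F2 by apply/negP => /nz2.
have z12 : red0 n k \notin labels F2 by apply/negP => /nz2.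
have z21 : blue0 n k \notin labels F1 by apply/negP => /nz1.
have [||||w1 r1] := @agrees_coherent p (red0 n k) F1; rewrite /= ?z1 //; try exact/allP.
  move=> v; rewrite memF => /orP[->//|/par2]; rewrite inE => /predU1P[->//|+ _].
  exact: d12.
have [||||w2 r2] := @agrees_coherent p (blue0 n k) F2; rewrite /= ?z2 //; try exact/allP.
  move=> v; rewrite memF orbC => /orP[->//|/par1]; rewrite inE => /predU1P[->//|pv _].
  by apply: contraL pv => /d12.
exists p => //; apply/and4P; split; rewrite /=.
- apply/eqP; apply: (irr_sorted_eq (@sib_lt_trans p) (@sib_lt_irr p)).
  + exact: weakly_coherent_sorted w1 v1.
  + exact: child_seq_sorted.
  move=> v; rewrite mem_child_seq memF; have [vF|vF] := boolP (v \in labels F1).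
    by rewrite r1.
  rewrite [LHS](contraNF (@root_seq_labels F1 v) vF) /=.
  have [/par2|//] := boolP (v \in labels F2); rewrite inE => /predU1P[->//|pv].
  by apply/esym/negbTE; apply: contraNneq z12 => <-.
- apply/eqP; apply: (irr_sorted_eq (@sib_lt_trans p) (@sib_lt_irr p)).
  + exact: weakly_coherent_sorted w2 v2.
  + exact: child_seq_sorted.
  move=> v; rewrite mem_child_seq memF orbC; have [vF|vF] := boolP (v \in labels F2).
    by rewrite r2.
  rewrite [LHS](contraNF (@root_seq_labels F2 v) vF) /=.
  have [/par1|//] := boolP (v \in labels F1); rewrite inE => /predU1P[->//|pv].
  by apply/esym/negbTE; apply: contraNneq z21 => <-.
- exact: weakly_coherent_coherent w1 v1 vp.
- exact: weakly_coherent_coherent w2 v2 vp.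
Qed.

End ParentMaps.

(** * Trees given by arcs, and their parent maps *)

Section Trees.
Variables n k : nat.
Local Notation V := (symbol n k).
Implicit Types (u v x y r : V) (c : bool) (t : tree_data V).
Implicit Types (p q : {ffun V -> V}) (T : tree_data V * tree_data V).

Lemma rooted_treeP r t : is_rooted_tree r t ->
  [/\ r \in vertices t,
      forall v u, child_of t v u -> v \in vertices t /\ u \in vertices t,
      forall v, child_of t v r = false,
      forall u, u \in vertices t -> u != r -> exists v, forall w, child_of t w u = (w == v)
    & forall u, u \in vertices t -> connect (child_of t) r u].
Proof.
case/and5P=> rt /forallP arc /forallP nor /forallP one /forallP con; split=> //.
- by move=> v u vu; have /forallP/(_ u) := arc v; rewrite vu => /andP[].
- by move=> v; apply/negbTE.
- move=> u ut ur; have := one u; rewrite ut ur => /cards1P[v /setP e].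
  by exists v => w; have := e w; rewrite !inE.
by move=> u ut; have := con u; rewrite ut.
Qed.

(* A cycle of length 2 would be closed under taking parents, so it could not be
   reached from the root. *)
Lemma rooted_tree_no_2cycle r t u v : is_rooted_tree r t ->
  child_of t u v -> child_of t v u -> false.
Proof.
case/rooted_treeP=> rt arc nor one con uv vu.
have back x y : child_of t x y -> y \in [:: u; v] -> x \in [:: u; v].
  rewrite !inE => xy /orP[]/eqP e; subst y.
    have [|w ew] := one u (proj2 (arc _ _ vu)); first by apply: contraTneq vu => ->; rewrite nor.
    by move: xy vu; rewrite !ew => /eqP-> /eqP->; rewrite eqxx orbT.
  have [|w ew] := one v (proj2 (arc _ _ uv)); first by apply: contraTneq uv => ->; rewrite nor.
  by move: xy uv; rewrite !ew => /eqP-> /eqP->; rewrite eqxx.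
have /connectP[q pq] := con u (proj1 (arc _ _ uv)).
have : u \in [:: u; v] by rewrite mem_head.
move=> + eu; rewrite {1}eu {eu}; elim/last_ind: q pq => [_|q x IH] /=.
  by rewrite !inE => /orP[]/eqP e; move: vu uv; rewrite -e nor.
rewrite rcons_path last_rcons => /andP[pq /back b] /b; exact: IH.
Qed.

(** The default value makes the two roots, which have no incoming arc, fixed points, as
    [is_parent_map] demands. *)
Definition parent_of T : {ffun V -> V} :=
  [ffun v => odflt v [pick u | child_of T.1 u v || child_of T.2 u v]].

Section TreeParent.
Variable T : tree_data V * tree_data V.
Hypothesis vT : is_double_alt_tree T.
Local Notation p := (parent_of T).

Lemma vertices2E v : (v \in vertices T.2) = (v \notin vertices T.1).
Proof.
have /and5P[_ _ /eqP/setP/(_ v) + dis _] := vT; rewrite !inE.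
have [v1 _|//] := boolP (v \in vertices T.1).
by rewrite (disjointFr dis).
Qed.

Lemma arc_parent u v :
  child_of T.1 u v || child_of T.2 u v = (label v != 0) && (p v == u).
Proof.
have /and5P[/rooted_treeP[r1 arc1 nor1 one1 _] /rooted_treeP[r2 arc2 nor2 one2 _] _ _ _] := vT.
have n21 w : child_of T.1 w (blue0 n k) = false.
  by apply/negP => /arc1[_]; apply/negP; rewrite -vertices2E.
have n12 w : child_of T.2 w (red0 n k) = false.
  by apply/negP => /arc2[_]; rewrite vertices2E r1.
have [v0|v0] := eqVneq (label v) 0.
  by rewrite (label0P v0); case: (red v); rewrite ?n12 ?nor1 ?nor2 ?n21.
have vr : v != red0 n k by apply: contraNneq v0 => ->.
have vb : v != blue0 n k by apply: contraNneq v0 => ->.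
have [w ew] : exists w, forall x, child_of T.1 x v || child_of T.2 x v = (x == w).
  have [v1|v1] := boolP (v \in vertices T.1).
    have [w ew] := one1 v v1 vr; exists w => x; rewrite ew.
    by rewrite (_ : child_of T.2 x v = false) ?orbF //; apply/negP => /arc2[_]; rewrite vertices2E v1.
  have v2 : v \in vertices T.2 by rewrite vertices2E.
  have [w ew] := one2 v v2 vb; exists w => x; rewrite ew.
  by rewrite (_ : child_of T.1 x v = false) //; apply/negP => /arc1[_]; apply/negP.
rewrite ew ffunE; case: pickP => [x|/(_ w)]; last by rewrite ew eqxx.
by rewrite ew => /eqP->; rewrite eq_sym.
Qed.

Lemma child_of1E u v :
  child_of T.1 u v = [&& label v != 0, p v == u & v \in vertices T.1].
Proof.
have /and5P[/rooted_treeP[_ arc1 _ _ _] /rooted_treeP[_ arc2 _ _ _] _ _ _] := vT.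
rewrite andbA -arc_parent; have [v1|v1] := boolP (v \in vertices T.1).
  rewrite andbT (_ : child_of T.2 u v = false) ?orbF //.
  by apply/negP => /arc2[_]; rewrite vertices2E v1.
by rewrite andbF; apply/negP => /arc1[_]; apply/negP.
Qed.

Lemma child_of2E u v :
  child_of T.2 u v = [&& label v != 0, p v == u & v \notin vertices T.1].
Proof.
have /and5P[/rooted_treeP[_ arc1 _ _ _] /rooted_treeP[_ arc2 _ _ _] _ _ _] := vT.
rewrite andbA -arc_parent; have [v1|v1] := boolP (v \in vertices T.1).
  by rewrite andbF; apply/negP => /arc2[_]; rewrite vertices2E v1.
rewrite andbT (_ : child_of T.1 u v = false) //.
by apply/negP => /arc1[_]; apply/negP.
Qed.

Lemma vertices1_parent v : label v != 0 -> (p v \in vertices T.1) = (v \in vertices T.1).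
Proof.
have /and5P[/rooted_treeP[_ arc1 _ _ _] /rooted_treeP[_ arc2 _ _ _] _ _ _] := vT.
move=> v0; have [v1|v1] := boolP (v \in vertices T.1).
  by have [|-> _] := arc1 (p v) v; rewrite ?child_of1E ?v0 ?eqxx.
have [|+ _] := arc2 (p v) v; first by rewrite child_of2E v0 eqxx.
by rewrite vertices2E => /negbTE.
Qed.

Lemma vertices1_zero : red0 n k \in vertices T.1 /\ blue0 n k \notin vertices T.1.
Proof.
have /and5P[/rooted_treeP[r1 _ _ _ _] /rooted_treeP[r2 _ _ _ _] _ _ _] := vT.
by rewrite -vertices2E.
Qed.

Lemma parent_of_valid : is_parent_map p.
Proof.
have /and5P[T1 T2 _ _ /and3P[/andP[/forallP al1 /forallP al2] /forallP in1 /forallP in2]] := vT.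
have p0 v : label v = 0 -> p v = v.
  move=> v0; rewrite ffunE; case: pickP => // u.
  by rewrite arc_parent v0.
apply/forallP => v; case: eqP => [/p0->//|/eqP v0].
have col : forall t, child_of t (p v) v ->
    (forall x, [forall y, child_of t x y ==> (red x != red y)]) -> red (p v) != red v.
  by move=> t cv /(_ (p v))/forallP/(_ v); rewrite cv.
have colv : red (p v) != red v.
  have := arc_parent (p v) v; rewrite v0 eqxx => /orP[/col/(_ al1)|/col/(_ al2)]; exact.
rewrite colv; have [pv0|pv0] := eqVneq (label (p v)) 0.
  by rewrite (p0 _ pv0) pv0 lt0n.
have grand t r : is_rooted_tree r t -> child_of t (p v) v -> child_of t (p (p v)) (p v) ->
    (forall x, [forall y, child_of t x y ==> (red x != red y)]) ->
    (forall x, [forall y, descendant t x y ==> (red x == red y) ==> (label x < label y)]) ->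
    label (p (p v)) < label v.
  move=> tr c1 c2 al inc; have /forallP/(_ v) := inc (p (p v)).
  (* [descendant] excludes the vertex itself, so the case of [v] being its own grandparent must be
     ruled out; this is a cycle of length 2. *)
  have -> : descendant t (p (p v)) v.
    rewrite /descendant (connect_trans (connect1 c2) (connect1 c1)) andbT.
    by apply/negP => /eqP e; rewrite -e in c2; have := rooted_tree_no_2cycle tr c1 c2.
  suff -> : red (p (p v)) == red v by [].
  have := al (p (p v)) => /forallP/(_ (p v)); rewrite c2 /=.
  by move: colv; case: (red v) (red (p v)) (red (p (p v))) => [] [] [].
have [v1|v1] := boolP (v \in vertices T.1).
  by apply: grand T1 _ _ al1 in1; rewrite child_of1E ?vertices1_parent ?v1 ?v0 ?pv0 ?eqxx.
by apply: grand T2 _ _ al2 in2; rewrite child_of2E ?vertices1_parent ?v1 ?v0 ?pv0 ?eqxx.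
Qed.

End TreeParent.

(** The parent map does not record which tree contains a vertex, but a vertex lies in the same tree
    as its parent, so climbing to a root recovers this. *)
Lemma parent_of_inj T T' : is_double_alt_tree T -> is_double_alt_tree T' ->
  parent_of T = parent_of T' -> T = T'.
Proof.
move=> vT vT' e; have vp := parent_of_valid vT.
have e1 v : (v \in vertices T.1) = (v \in vertices T'.1).
  have [m] := ubnP (rank (parent_of T) v); elim: m v => // m IH v /ltnSE le_m.
  have [v0|v0] := eqVneq (label v) 0.
    have [r1 b1] := vertices1_zero vT; have [r1' b1'] := vertices1_zero vT'.
    by rewrite (label0P v0); case: (red v); rewrite ?r1 ?r1' ?(negPf b1) ?(negPf b1').
  rewrite -(vertices1_parent vT v0) -(vertices1_parent vT' v0) -e.
  by apply: IH; apply: leq_trans (rank_parent vp v0) le_m.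
have e2 v : (v \in vertices T.2) = (v \in vertices T'.2) by rewrite !vertices2E ?e1.
have a1 u v : ((u, v) \in T.1.2) = ((u, v) \in T'.1.2).
  have := child_of1E vT u v; have := child_of1E vT' u v.
  by rewrite /child_of => -> ->; rewrite e e1.
have a2 u v : ((u, v) \in T.2.2) = ((u, v) \in T'.2.2).
  have := child_of2E vT u v; have := child_of2E vT' u v.
  by rewrite /child_of => -> ->; rewrite e e1.
case: T T' {vT vT' e vp} e1 e2 a1 a2 => [[V1 A1] [V2 A2]] [[V1' A1'] [V2' A2']] /= e1 e2 a1 a2.
by congr ((_, _), (_, _)); apply/setP => // -[u v].
Qed.

Lemma w_chE (D : double_alt_tree n k) :
  w_ch D = #|[set v | [&& label v != 0, parent_of (val D) v == red0 n k &
                         has_child (parent_of (val D)) v]]|.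
Proof.
have vT := valP D; have [r1 _] := vertices1_zero vT.
rewrite /w_ch; apply: eq_card => v; rewrite !inE child_of1E //.
have [v0|//] := boolP (label v != 0); case: eqP => //= pv.
have v1 : v \in vertices (val D).1 by rewrite -vertices1_parent // pv.
rewrite v1 /=; apply/set0Pn/existsP => -[u]; rewrite ?inE ?child_of1E //.
  by case/and3P=> u0 pu _; exists u; rewrite u0.
case/andP=> u0 /eqP pu; exists u.
by rewrite inE child_of1E // u0 pu eqxx -vertices1_parent // pu.
Qed.

Section TreesOfParent.
Variable p : {ffun V -> V}.
Hypothesis vp : is_parent_map p.

(** The root above [v]: [rank] is at most [(n + k).*2] and drops at each step, so this many steps
    suffice, and further ones are harmless because roots are fixed. *)
Definition ancestor v : V := iter (n + k).*2 p v.

Lemma iter_zero m v : label v = 0 -> iter m p v = v.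
Proof. by move=> v0; elim: m => //= m ->; rewrite parent_zero. Qed.

Lemma ancestor_zero v : label v = 0 -> ancestor v = v.
Proof. exact: iter_zero. Qed.

Lemma label_ancestor v : label (ancestor v) = 0.
Proof.
have : rank p v <= (n + k).*2.
  by rewrite /rank -addnn leq_add ?label_bound.
rewrite /ancestor; elim: (n + k).*2 v => [|m IH] v.
  by rewrite leqn0 addn_eq0 => /andP[/eqP].
move=> le_m; have [v0|v0] := eqVneq (label v) 0; first by rewrite iter_zero.
rewrite iterSr; apply: IH; rewrite -ltnS; apply: leq_trans le_m.
exact: rank_parent.
Qed.

Lemma ancestor_parent v : ancestor (p v) = ancestor v.
Proof. by rewrite /ancestor -iterSr iterS parent_zero ?label_ancestor. Qed.

Definition tree_at r : tree_data V :=
  ([set v | ancestor v == r],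
   [set a | [&& label a.2 != 0, p a.2 == a.1 & ancestor a.2 == r]]).

Lemma child_of_tree_at r u v :
  child_of (tree_at r) u v = [&& label v != 0, p v == u & ancestor v == r].
Proof. by rewrite /child_of inE. Qed.

Lemma tree_at_rooted r : label r = 0 -> is_rooted_tree r (tree_at r).
Proof.
move=> r0; apply/and5P; split.
- by rewrite inE ancestor_zero.
- apply/forallP => v; apply/forallP => u; apply/implyP.
  rewrite child_of_tree_at !inE => /and3P[_ /eqP<- ur].
  by rewrite ancestor_parent ur.
- by apply/forallP => v; rewrite child_of_tree_at r0.
- apply/forallP => u; apply/implyP; rewrite inE => ur; apply/implyP => nur.
  apply/cards1P; exists (p u); apply/setP => v; rewrite !inE child_of_tree_at ur andbT.
  rewrite eq_sym; case: eqP => // u0.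
  by rewrite -(eqP ur) ancestor_zero // eqxx in nur.
apply/forallP => u; apply/implyP; rewrite inE.
have [m] := ubnP (rank p u); elim: m u => // m IH u /ltnSE le_m ur.
have [u0|u0] := eqVneq (label u) 0; first by rewrite -(eqP ur) ancestor_zero.
apply: (@connect_trans _ _ (p u)).
  by apply: IH; rewrite ?ancestor_parent //; apply: leq_trans (rank_parent vp u0) le_m.
by apply: connect1; rewrite child_of_tree_at u0 ur eqxx.
Qed.

Lemma tree_at_alternating r : alternating (tree_at r).
Proof.
apply/forallP => v; apply/forallP => u; apply/implyP.
rewrite child_of_tree_at => /and3P[u0 /eqP<- _].
by rewrite (parent_color vp u0); case: (red u).
Qed.

Lemma tree_at_increasing r : increasing_by_color (tree_at r).
Proof.
apply/forallP => v; apply/forallP => u; apply/implyP => /andP[uv /connectP[q pq eu]].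
apply/implyP => /eqP cuv.
(* Invariant along a downward path from [v]. At vertices of the other color it speaks of the parent,
   so that each step needs only the comparison with the grandparent. *)
pose Q x := if red x == red v then x = v \/ label v < label x
            else label v <= label (p x).
suff : Q u by rewrite /Q cuv eqxx => -[e|//]; rewrite e eqxx in uv.
rewrite eu {eu uv cuv}; elim/last_ind: q pq => [_|q x IH] /=.
  by rewrite /Q eqxx; left.
rewrite rcons_path last_rcons child_of_tree_at => /and4P[/IH + x0 /eqP px _].
rewrite -px /Q (parent_color vp x0).
have lt_x := grandparent_lt vp x0.
case: (red x) (red v) => [] [] /= Qp; try by right; apply: leq_ltn_trans lt_x.
  by case: Qp => [->|/ltnW].
by case: Qp => [->|/ltnW].
Qed.

Definition trees_of_parent : tree_data V * tree_data V :=
  (tree_at (red0 n k), tree_at (blue0 n k)).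

Lemma trees_of_parent_valid : is_double_alt_tree trees_of_parent.
Proof.
rewrite /is_double_alt_tree !tree_at_rooted // !tree_at_alternating !tree_at_increasing /=.
rewrite andbT; apply/andP; split.
  apply/eqP/setP => v; rewrite !inE (label0P (label_ancestor v)).
  by case: (red _); rewrite eqxx ?orbT.
by apply/pred0P => v; rewrite /= !inE; case: eqP => // ->.
Qed.

Lemma trees_of_parentK : parent_of trees_of_parent = p.
Proof.
have vT := trees_of_parent_valid; apply/ffunP => v.
have [v0|v0] := eqVneq (label v) 0.
  by rewrite (parent_zero (parent_of_valid vT)) // parent_zero.
apply/eqP; have := arc_parent vT (p v) v; rewrite v0 andTb => <-.
rewrite !child_of_tree_at v0 eqxx /= (label0P (label_ancestor v)).
by case: (red _); rewrite eqxx ?orbT.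
Qed.

End TreesOfParent.
End Trees.

(** * Assembling the bijection *)

Section Bijection.
Variables n k : nat.
Local Notation V := (symbol n k).

Lemma size_nonzero_symbols : size [seq v <- enum V | label v != 0] = n + k.
Proof.
rewrite -sum1_size big_filter big_enum_cond /= sum1_card.
transitivity #|[predC pred2 (red0 n k) (blue0 n k)]|.
  apply: eq_card => v; rewrite !inE; congr (~~ _).
  apply/eqP/orP => [/label0P->|[]/eqP-> //].
  by case: (red v); [left|right].
have := cardC (pred2 (red0 n k) (blue0 n k)).
rewrite card2 card_sum !card_ord /= => e.
by apply: (@addnI 2); rewrite [LHS]e addnS.
Qed.

(** The graph of the bijection, with the pair of forests as intermediate witness. Totality on both
    sides yields maps [g] and [h] by choice on finite types, and uniqueness on both sides makes them
    mutually inverse. *)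
Definition same_code (T : double_alt_tree n k) (S : double_callan n k) : Prop :=
  exists F : forest V * forest V,
    [/\ represents (parent_of (val T)) F, word F.1 = (val S).1 & word F.2 = (val S).2].

Lemma starts_blueE (s : seq V) : starts_blue s = starts false s.
Proof. by case: s => //= x s; case: (red x). Qed.

Lemma starts_redE (s : seq V) : starts_red s = starts true s.
Proof. by case: s => //= x s; case: (red x). Qed.

Lemma same_code_exists T : exists S, same_code T S.
Proof.
have vp := parent_of_valid (valP T).
have [F rF] := represents_exists vp; have [v1 v2] := represents_valid vp rF.
have pF : perm_eq (word F.1 ++ word F.2) [seq v <- enum V | label v != 0].
  by apply: perm_trans (perm_labels vp rF); rewrite perm_cat ?perm_word.
have := perm_size pF; rewrite size_nonzero_symbols size_cat => sz.
have sz1 : size (word F.1) <= n + k by rewrite -sz leq_addr.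
have sz2 : size (word F.2) <= n + k by rewrite -sz leq_addl.
have cS : is_double_callan (Bseq sz1) (Bseq sz2).
  rewrite /is_double_callan pF starts_blueE starts_redE !decreasing_runs /=.
  by rewrite (valid_word_starts v1) (valid_word_starts v2) (valid_word_sorted v1)
             (valid_word_sorted v2).
by exists (exist _ (Bseq sz1, Bseq sz2) cS); exists F.
Qed.

Lemma same_code_surj S : exists T, same_code T S.
Proof.
have /and5P[pS] := valP S; rewrite starts_blueE starts_redE !decreasing_runs => st1 st2 so1 so2.
have := perm_uniq pS; rewrite filter_uniq ?enum_uniq // cat_uniq => /and3P[u1 _ u2].
have inj (s : seq V) : {in s &, forall x y, red x = red y -> label x = label y -> x = y}.
  by move=> x y _ _; apply: symbol_inj.
have [|F1 v1 e1] := word_surj (c := false) _ u1 (inj _); first exact/andP.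
have [|F2 v2 e2] := word_surj (c := true) _ u2 (inj _); first exact/andP.
have [|p vp rp] := represents_surj (F := (F1, F2)) v1 v2.
  by apply: perm_trans pS; rewrite -e1 -e2 perm_cat // perm_sym perm_word.
exists (exist _ (trees_of_parent p) (trees_of_parent_valid vp)); exists (F1, F2).
by rewrite /= trees_of_parentK.
Qed.

Lemma same_code_fun T S S' : same_code T S -> same_code T S' -> S = S'.
Proof.
move=> [F [rF e1 e2]] [F' [rF' e1' e2']]; apply: val_inj.
move: e1' e2'; rewrite -(represents_uniq rF rF') e1 e2.
by case: (val S) (val S') => [a b] [a' b'] /= /val_inj-> /val_inj->.
Qed.

Lemma same_code_inj T T' S : same_code T S -> same_code T' S -> T = T'.
Proof.
move=> [[F1 F2] [rF /= e1 e2]] [[F1' F2'] [rF' /= e1' e2']]; apply: val_inj.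
have vp := parent_of_valid (valP T); have vp' := parent_of_valid (valP T').
have [/= v1 v2] := represents_valid vp rF; have [/= v1' v2'] := represents_valid vp' rF'.
have eF1 : F1 = F1' by apply: word_inj v1 v1' _; rewrite e1.
have eF2 : F2 = F2' by apply: word_inj v2 v2' _; rewrite e2.
subst F1' F2'; apply: parent_of_inj (valP T) (valP T') _.
exact: represents_inj vp vp' rF rF'.
Qed.

Lemma same_code_weight T S : same_code T S -> w_lr S = w_ch T.
Proof.
move=> [F [rF e1 e2]]; have vp := parent_of_valid (valP T).
have [v1 _] := represents_valid vp rF; have /and4P[/eqP r1 _ c1 _] := rF.
rewrite w_lrE w_chE -e1 (nb_minima_word v1) ?(nb_nonleafE c1 r1) //.
(* The initial bound [(n + k).+1] lies above every label, so the first non-leaf root always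
   counts. *)
by move=> v G1 G2 _; rewrite ltnS label_bound orbT.
Qed.

End Bijection.

Import GRing.Theory.
Local Open Scope ring_scope.

Theorem theorem3p7 (n k : nat) :
  (exists g : double_alt_tree n k -> double_callan n k,
     bijective g /\ forall T : double_alt_tree n k, w_lr (g T) = w_ch T)
  /\ \sum_(T : double_alt_tree n k) 'X^(w_ch T)
     = \sum_(S : double_callan n k) 'X^(w_lr S) :> {poly int}.
Proof.
have [g gP] := fin_all_exists (@same_code_exists n k).
have [h hP] := fin_all_exists (@same_code_surj n k).
have gK : cancel g h by move=> T; apply: same_code_inj (hP _) (gP T).
have hK : cancel h g by move=> S; apply: same_code_fun (gP _) (hP S).
have gB : bijective g by exists h.
have gw T : w_lr (g T) = w_ch T by apply: same_code_weight.
split; first by exists g.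
rewrite [RHS](reindex g) /=; last exact: onW_bij.
by apply: eq_bigr => T _; rewrite gw.
Qed.
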